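(* Let $H\in(\tfrac12,1)$, let $B^H$ be a (one-dimensional) fractional Brownian motion with Hurst parameter $H$, and let $U:\mathbb{R}^n\to\mathbb{R}^n$ be a deterministic vector field with components $U^i$ and spatial derivative $W=(W^i_j)_{i,j}$, $W^i_j=\partial U^i/\partial x^j$, for which there are constants $M_U, M_U^{(1)}, M_U^{(2)}$ such that for all $x,y\in\mathbb{R}^n$ and all $i,j\in\{1,\dots,n\}$: $$|U^i(x)|\le M_U,\qquad |U^i(x)-U^i(y)|\le M_U^{(1)}\|x-y\|_2,\qquad |W^i_j(x)-W^i_j(y)|\le M_U^{(2)}\|x-y\|_2 .$$ Let $\Phi_t:\mathbb{R}^n\to\mathbb{R}^n$, $t\ge 0$, be the stochastic flow defined by $$\Phi_t(x)=x+\int_0^t U(\Phi_s(x))\,dB^H(s),\qquad x\in\mathbb{R}^n .$$ Let $M$ be an $m$-dimensional $C^2$ manifold embedded in $\mathbb{R}^n$, $m<n$, and let $M_t=\Phi_t(M)$. Then for every $\beta\in(0,H)$ there exist (deterministic) constants $c_1$ and $C_1$ such that, for every $T>0$, almost surely, $$\sup_{t\in[0,T]}\mathcal{H}_m(M_t)\;\le\; c_1\,\mathcal{H}_m(M)\;2^{\,C_1\,T\,\|B^H\|_{\beta,T}^{1/\beta}} .$$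
   Context: A fractional Brownian motion with Hurst parameter $H\in(0,1)$ is the zero mean Gaussian process $\{B^H(t),t\ge0\}$ (taken with continuous sample paths) with covariance $E[B^H(s)B^H(t)]=\frac12(t^{2H}+s^{2H}-|t-s|^{2H})$. $\|\cdot\|_2$ is the Euclidean norm. For a function $f$ on $[0,T]$ and $\lambda\in(0,1]$, the $\lambda$-Hölder norm is $\|f\|_{\lambda,T}=\sup_{0\le c<d\le T}\frac{\|f(d)-f(c)\|_2}{|d-c|^{\lambda}}$. The stochastic integral is the pathwise generalized Stieltjes integral of Zähle; for integrand $f$ that is $\lambda$-Hölder and integrator $g$ that is $\mu$-Hölder with $\lambda+\mu>1$ (as is the case here) it coincides with the Riemann–Stieltjes integral. For each starting point $x$, the flow equation has a unique solution $t\mapsto\Phi_t(x)$ in the space of $(1-\alpha)$-Hölder continuous functions on $[0,T]$, for $\alpha\in(1-H,\frac12)$. $\mathcal{H}_m$ denotes $m$-dimensional Hausdorff measure. *)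

(* Defs.v *)
From HB Require Import structures.
From mathcomp Require Import all_boot all_order all_algebra.
From mathcomp Require Import all_classical all_reals all_analysis.

Set Implicit Arguments.
Unset Strict Implicit.
Unset Printing Implicit Defensive.

Import Order.TTheory GRing.Theory Num.Theory.
Import numFieldNormedType.Exports.

Local Open Scope classical_set_scope.
Local Open Scope ring_scope.

Section euclidean.
Context {R : realType}.

(* The canonical norm of MathComp-Analysis on ['rV[R]_n] is the sup norm. *)
Definition enorm2 n (x : 'rV[R]_n) : R := Num.sqrt (\sum_(i < n) x 0 i ^+ 2).

(* [N] is the norm of the target space: [enorm2] on R^n, [Num.norm] on R.
   The value is [+oo] when [f] is not Hoelder continuous on [0, T]. *)
Definition holder_norm (V : zmodType) (N : V -> R) (lam T : R) (f : R -> V)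
    : \bar R :=
  ereal_sup [set z | exists c d : R, [/\ 0 <= c, c < d, d <= T &
    z = (N (f d - f c) / `|d - c| `^ lam)%:E]].

(* 2 ^ x for an extended real x. *)
Definition pow2e (x : \bar R) : \bar R :=
  match x with
  | r%:E => (2 `^ r)%:E
  | +oo%E => +oo%E
  | -oo%E => 0%E
  end.

End euclidean.

Section hausdorff_measure.
Context {R : realType} {n : nat}.
Implicit Types A : set 'rV[R]_n.

Definition ediam A : \bar R :=
  ereal_sup [set (enorm2 (x - y))%:E | x in A & y in A].

(* With m = 0, a nonempty set has gauge 1 and the empty set has gauge 0, so
   that the 0-dimensional measure is the counting measure. *)
Definition hausdorff_gauge (m : nat) A : \bar R :=
  if A == set0 then 0%E else (ediam A ^+ m)%E.

Definition hausdorff_pre (m : nat) (delta : R) A : \bar R :=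
  ereal_inf [set (\sum_(0 <= k <oo) hausdorff_gauge m (F k))%E
    | F in [set F : nat -> set 'rV[R]_n |
        A `<=` \bigcup_k F k /\ forall k, (ediam (F k) <= delta%:E)%E]].

(* No normalizing factor (volume of the ball of diameter 1) is used. *)
Definition hausdorff_measure (m : nat) A : \bar R :=
  ereal_sup [set hausdorff_pre m delta A | delta in [set d : R | 0 < d]].

End hausdorff_measure.

Section submanifold.
Context {R : realType}.

Definition partial m (j : 'I_m) (f : 'rV[R]_m -> R) : 'rV[R]_m -> R :=
  fun x => 'D_(delta_mx 0 j) f x.

(* [f] is of class C^k on the open set [W]. *)
Fixpoint class_C m (k : nat) (W : set 'rV[R]_m) (f : 'rV[R]_m -> R) : Prop :=
  (forall x, W x -> {for x, continuous f}) /\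
  match k with
  | 0%N => True
  | k'.+1 => forall j : 'I_m,
      (forall x, W x -> derivable f x (delta_mx 0 j)) /\
      class_C k' W (partial j f)
  end.

(* [M] is an embedded m-dimensional C^k submanifold (without boundary) of R^n:
   near each of its points it is the image of an open subset of R^m under a C^k
   immersion that is a homeomorphism onto its image. *)
Definition embedded_submanifold (k m n : nat) (M : set 'rV[R]_n) : Prop :=
  forall p, M p ->
  exists (V : set 'rV[R]_n) (W : set 'rV[R]_m)
         (psi : 'rV[R]_m -> 'rV[R]_n) (phi : 'rV[R]_n -> 'rV[R]_m),
  [/\ open V /\ V p, open W,
      (forall i : 'I_n, class_C k W (fun w => psi w 0 i)),
      (forall w, W w ->
        row_free (\matrix_(j < m, i < n) partial j (fun w => psi w 0 i) w)) &
      [/\ psi @` W = M `&` V,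
          forall w, W w -> phi (psi w) = w &
          {within M `&` V, continuous phi}]].

End submanifold.

Section fractional_brownian_motion.
Context {R : realType} {d : measure_display} {Omega : measurableType d}
  {P : probability Omega R}.

(* Gaussian law, possibly degenerate: the library's [normal_prob mu 0] is not
   the Dirac mass at [mu]. *)
Definition gaussian_rv (X : {RV P >-> R}) : Prop :=
  (exists mu : R, forall A : set R, measurable A -> distribution P X A = \d_mu A) \/
  (exists mu s : R, 0 < s /\
     forall A : set R, measurable A -> distribution P X A = normal_prob mu s A).

Definition gaussian_process (B : R -> {RV P >-> R}) : Prop :=
  forall (k : nat) (t a : 'I_k -> R), (forall i, 0 <= t i) ->
    gaussian_rv (\sum_(i < k) a i *: B (t i)).

(* The time set is [0, +oo[; values of [B] at negative times are irrelevant. *)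
Definition fractional_brownian_motion (H : R) (B : R -> {RV P >-> R}) : Prop :=
  [/\ gaussian_process B,
      forall t : R, 0 <= t -> ('E_P[B t] = 0)%E,
      forall s t : R, 0 <= s -> 0 <= t ->
        ('E_P[(B s \* B t)%R])%E =
        (2^-1 * (s `^ (2 * H) + t `^ (2 * H) - `|t - s| `^ (2 * H)))%:E &
      forall w, {within `[0, +oo[, continuous (fun t : R => B t w)}].

End fractional_brownian_motion.

Section flow.
Context {R : realType}.

(* The Riemann-Stieltjes integral of [f] against [g] over [a, b] exists and
   equals [I]: [a :: s] lists the points of a partition, [xi] its tags. *)
Definition is_RS_integral (f g : R -> R) (a b I : R) : Prop :=
  forall eps : R, 0 < eps -> exists2 delta : R, 0 < delta &
  forall (s : seq R) (xi : nat -> R),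
    let x := nth b (a :: s) in
    itv_partition a b s ->
    (forall i, (i < size s)%N ->
       x i.+1 - x i < delta /\ x i <= xi i <= x i.+1) ->
    `|\sum_(i < size s) f (xi i) * (g (x i.+1) - g (x i)) - I| < eps.

(* [t |-> Phi t x] solves Phi_t(x) = x + \int_0^t U(Phi_s(x)) dg(s), t >= 0,
   in the space of lam-Hoelder functions, for every starting point [x]. *)
Definition is_flow n (lam : R) (U : 'rV[R]_n -> 'rV[R]_n) (g : R -> R)
    (Phi : R -> 'rV[R]_n -> 'rV[R]_n) : Prop :=
  forall x,
    (forall T : R, 0 < T ->
       (holder_norm (@enorm2 R n) lam T (Phi^~ x) < +oo)%E) /\
    (forall t : R, 0 <= t -> forall i : 'I_n,
       is_RS_integral (fun s => U (Phi s x) 0 i) g 0 t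
         (Phi t x 0 i - x 0 i)).

End flow.

(* Main.v *)
Require Import Defs.
From HB Require Import structures.
From mathcomp Require Import all_boot all_order all_algebra.
From mathcomp Require Import all_classical all_reals all_analysis.
From mathcomp Require Import zify ring lra.

Import Order.TTheory GRing.Theory Num.Theory.
Import numFieldNormedType.Exports.

Local Open Scope classical_set_scope.
Local Open Scope ring_scope.

Set Implicit Arguments.
Unset Strict Implicit.
Unset Printing Implicit Defensive.

(** The noise is one-dimensional, so the flow is explicit (Doss-Sussmann): if
[phi] denotes the flow of the autonomous equation [y' = U y], then
[Phi_t x = phi (B_t - B_0) x] ([flow_eq_euler_flow]).  The Lipschitz constant of
[phi s] is at most [exp (L |s|)], where [L] is a Lipschitz constant of [U].
Hence [Phi_t] has a Lipschitz constant [K] of order [exp (L |B_t - B_0|)]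
([flow_lipschitz]), and a [K]-Lipschitz map multiplies [m]-dimensional Hausdorff
measure by at most [K ^ m] ([hausdorff_measure_lipschitz]).  Finally
[|B_t - B_0| <= y := T ^ beta * ||B||_beta], and [y <= 1 + y ^ (1 / beta)] because
[beta <= 1]; the constant 1 goes into [c1], while
[y ^ (1 / beta) = T * ||B||_beta ^ (1 / beta)] is the announced exponent
([expR_le_pow2]).  This argument works path by path.

The representation of [Phi] rests on three facts.  First, [phi] is built as a
limit of Euler polygons on dyadic grids; all its properties (group law,
Lipschitz bound, second order expansion, rest points) are limits of elementary
estimates for compositions of the steps [x + h U x], because the polygons
converge at a rate [2 ^ -k] that is uniform in [x].

Secondly, let [x_t] solve the integral equation driven by [g] and let
[R_k = x_(t_(k+1)) - x_(t_k) - U (x_(t_k)) (g_(t_(k+1)) - g_(t_k))] be the remainders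
along a partition.  Existence of the Riemann-Stieltjes integral for arbitrary
tags implies that even [\sum |R_k|] tends to 0 with the mesh
([sum_RS_remainder_le]): an argument in the style of Saks and Henstock, in which
the intervals whose remainder has the unwanted sign are refined.

Thirdly, [z_t = phi (g_0 - g_t) x_t] is constant: its increments are bounded by
[|R_k|] plus the square of the increment of [g], and the [|R_k|] sum to 0 in the
limit.  As long as [|U x_t| >= c > 0], the increment of [g] is at most
[(|x_(t_(k+1)) - x_(t_k)| + |R_k|) / c], whose squares sum to 0 because [x] is
Hoelder continuous of order greater than 1/2
([solution_flow_nondegenerate]).  The field cannot vanish at one point of the
path without vanishing at all of them: up to the first zero the path would follow
[phi], and so would reach a rest point of [phi] in finite time
([zero_everywhere]).  If [U] vanishes along the whole path, the path is
constant. *)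

(** * Dyadic limits *)

Section dyadic_limits.
Context {R : realType}.

Lemma exists_half_pow_le (C e : R) : 0 < e -> exists k, C * 2^-1 ^+ k <= e.
Proof.
move=> e0; exists (Num.truncn (`|C| / e)).
set k := Num.truncn _.
have lt_k : `|C| / e < k.+1%:R by exact: truncnS_gt.
have k2 : k.+1%:R <= 2 ^+ k :> R by rewrite -natrX ler_nat ltn_expl.
rewrite exprVn ler_pdivrMr ?exprn_gt0// mulrC -ler_pdivrMr//.
apply: le_trans k2; apply: le_trans (ltW lt_k).
by rewrite ler_pM2r ?invr_gt0// ler_norm.
Qed.

(** Inequalities between limits of dyadic schemes are proved with this lemma,
from bounds that hold at every level [k] up to an error [C 2 ^ -k]. *)
Lemma ler_half_pow (a b C : R) :
  (forall k, a <= b + C * 2^-1 ^+ k) -> a <= b.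
Proof.
move=> abC; apply/ler_addgt0Pr => e e0.
have [k Ck] := exists_half_pow_le C e0.
by apply: le_trans (abC k) _; rewrite lerD2l.
Qed.

Lemma dist_half_pow_limn {V : completeNormedModType R} (u : nat -> V) (A : R) :
  (forall k, `|u k.+1 - u k| <= A * 2^-1 ^+ k) ->
  forall k, `|u k - limn u| <= 2 * A * 2^-1 ^+ k.
Proof.
move=> uA.
have A0 : 0 <= A.
  by have := le_trans (normr_ge0 _) (uA 0%N); rewrite expr0 mulr1.
have tail k j : `|u (k + j)%N - u k| <= 2 * A * 2^-1 ^+ k.
  suff : `|u (k + j)%N - u k| <= 2 * A * (2^-1 ^+ k - 2^-1 ^+ (k + j)).
    move/le_trans; apply; rewrite ler_wpM2l ?mulr_ge0// gerBl.
    by rewrite exprn_ge0.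
  elim: j => [|j IH]; first by rewrite addn0 !subrr normr0 mulr0.
  rewrite addnS; apply: le_trans (ler_distD (u (k + j)%N) _ _) _.
  apply: le_trans (lerD (uA _) IH) _.
  rewrite exprS; set a := 2^-1 ^+ (k + j); set b := 2^-1 ^+ k.
  by rewrite le_eqVlt; apply/orP; left; apply/eqP; field.
have cu : cvgn u.
  apply/cauchy_cvgP/cauchy_exP => e e0.
  have [k ke] := exists_half_pow_le (2 * A) (divr_gt0 e0 (ltr0Sn R 1)).
  exists (u k), k => // i /= ki; rewrite -ball_normE /= distrC -(subnKC ki).
  apply: le_lt_trans (tail _ _) _; apply: le_lt_trans ke _.
  by rewrite ltr_pdivrMr// mulr_natr mulr2n ltrDl.
move=> k.
have cuk : `|u k - u j| @[j --> \oo] --> `|u k - limn u|.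
  by apply: cvg_norm; apply: cvgB => //; exact: cvg_cst.
rewrite -(cvg_lim _ cuk)//; apply: limr_le; first by apply: cvgP cuk.
by exists k => // j /= kj; rewrite distrC -(subnKC kj).
Qed.

End dyadic_limits.

(** * The flow of a bounded Lipschitz field *)

Section iterates.
Context {R : realType} {V : normedModType R}.
Variables (A B : V -> V) (kappa e : R).
Hypotheses (kappa1 : 1 <= kappa) (e0 : 0 <= e)
  (lipA : forall x y, `|A x - A y| <= kappa * `|x - y|).

Lemma dist_iter_lipschitz j x y :
  `|iter j A x - iter j A y| <= kappa ^+ j * `|x - y|.
Proof.
elim: j => [|j IH] /=; first by rewrite expr0 mul1r.
apply: le_trans (lipA _ _) _; rewrite exprS -mulrA.
by rewrite ler_pM2l ?(lt_le_trans ltr01).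
Qed.

(** Each of the [j] replacements of [A] by [B] costs [e], and the remaining steps
amplify that error by at most [kappa ^ j]. *)
Lemma dist_iter_iter j x : (forall y, `|A y - B y| <= e) ->
  `|iter j A x - iter j B x| <= j%:R * kappa ^+ j * e.
Proof.
move=> AB; elim: j => [|j IH] /=; first by rewrite subrr normr0 !mul0r.
apply: le_trans (ler_distD (A (iter j B x)) _ _) _.
apply: le_trans (lerD (lipA _ _) (AB _)) _.
have k0 : 0 < kappa by exact: lt_le_trans ltr01 _.
apply: (@le_trans _ _ (kappa * (j%:R * kappa ^+ j * e) + e)).
  by rewrite lerD2r ler_pM2l.
rewrite -[j.+1]addn1 natrD mulrDl mul1r mulrDl addn1 exprS.
rewrite [_ * (_ * e)]mulrA [kappa * (j%:R * _)]mulrCA lerD2l.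
by rewrite ler_peMl// -exprS exprn_ege1.
Qed.

Lemma dist_iter_inverse j x : (forall y, `|A (B y) - y| <= e) ->
  `|iter j A (iter j B x) - x| <= j%:R * kappa ^+ j * e.
Proof.
move=> AB; elim: j => [|j IH]; first by rewrite subrr normr0 !mul0r.
rewrite [iter j.+1 A _]iterSr [iter j.+1 B _]iterS.
apply: le_trans (ler_distD (iter j A (iter j B x)) _ _) _.
have k0 : 0 < kappa by exact: lt_le_trans ltr01 _.
apply: (@le_trans _ _ (kappa ^+ j * e + j%:R * kappa ^+ j * e)).
  apply: lerD => //; apply: le_trans (dist_iter_lipschitz _ _ _) _.
  by rewrite ler_pM2l ?exprn_gt0.
rewrite -mulrDl -{1}[kappa ^+ j]mul1r -mulrDl nat1r.
by rewrite ler_wpM2r// ler_wpM2l// ler_weXn2l.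
Qed.

End iterates.

Section euler.
Context {R : realType} {V : completeNormedModType R}.

Definition euler_step (U : V -> V) (h : R) (x : V) : V := x + h *: U x.

(** All times share the grid of mesh [2 ^ -k], to which [s] is rounded down.
Composing polygons then means adding numbers of steps; dividing [[0, s]] into
[2 ^ k] equal parts would give grids that depend on [s]. *)
Definition euler_approx (U : V -> V) (k : nat) (s : R) : V -> V :=
  iter (Num.truncn (s * 2 ^+ k)) (euler_step U (2^-1 ^+ k)).

Definition euler_semiflow (U : V -> V) (s : R) (x : V) : V :=
  limn (fun k => euler_approx U k s x).

Section bounded_lipschitz_field.
Variables (U : V -> V) (L M : R).
Hypotheses (L0 : 0 <= L) (boundU : forall x, `|U x| <= M)
  (lipU : forall x y, `|U x - U y| <= L * `|x - y|).

Let M0 : 0 <= M. Proof. exact: le_trans (normr_ge0 _) (boundU 0). Qed.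

Lemma dist_euler_step h x y : 0 <= h ->
  `|euler_step U h x - euler_step U h y| <= (1 + h * L) * `|x - y|.
Proof.
move=> h0; rewrite /euler_step opprD addrACA -scalerBr mulrDl mul1r.
apply: le_trans (ler_normD _ _) _; rewrite lerD2l normrZ (ger0_norm h0) -mulrA.
by rewrite ler_wpM2l.
Qed.

Lemma dist_iter_euler_step h j x : 0 <= h ->
  `|iter j (euler_step U h) x - x| <= j%:R * h * M.
Proof.
move=> h0; elim: j => [|j IH]; first by rewrite subrr normr0 !mul0r.
rewrite iterS; apply: le_trans (ler_distD (iter j (euler_step U h) x) _ _) _.
rewrite {1}/euler_step addrAC subrr add0r normrZ (ger0_norm h0).
rewrite -[j.+1]add1n natrD !mulrDl mul1r.
by rewrite lerD// ler_wpM2l.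
Qed.

(** After [i] steps the polygon has moved by at most [i h M], so step [i] differs
from [h U x] by at most [h L i h M]; summing over [i] gives the square. *)
Lemma iter_euler_step_expansion h j x : 0 <= h ->
  `|iter j (euler_step U h) x - x - (j%:R * h) *: U x| <= L * M * (j%:R * h) ^+ 2.
Proof.
move=> h0; elim: j => [|j IH].
  by rewrite /= mul0r scale0r subrr subr0 normr0 expr0n mulr0.
rewrite iterS {1}/euler_step; set z := iter j _ x in IH *.
have -> : z + h *: U z - x - (j.+1%:R * h) *: U x =
    (z - x - (j%:R * h) *: U x) + h *: (U z - U x).
  rewrite -[j.+1]addn1 natrD mulrDl mul1r scalerDl scalerBr.
  by rewrite [z + _ - x]addrAC opprD addrACA.
apply: le_trans (ler_normD _ _) _; apply: le_trans (lerD IH (lexx _)) _.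
rewrite normrZ (ger0_norm h0).
have zx : `|U z - U x| <= L * (j%:R * h * M).
  by apply: le_trans (lipU _ _) _; rewrite ler_wpM2l// dist_iter_euler_step.
apply: le_trans (lerD (lexx _) (ler_wpM2l h0 zx)) _.
rewrite -subr_ge0 -[j.+1]addn1 natrD.
set J := j%:R.
have -> : L * M * ((J + 1) * h) ^+ 2 - (L * M * (J * h) ^+ 2 + h * (L * (J * h * M))) =
   L * M * h ^+ 2 * (J + 1) by ring.
by rewrite !mulr_ge0 ?exprn_ge0// addr_ge0.
Qed.

Lemma truncn_half_pow (s : R) k : 0 <= s ->
  s - 2^-1 ^+ k <= (Num.truncn (s * 2 ^+ k))%:R * 2^-1 ^+ k <= s.
Proof.
move=> s0; have p0 : 0 < 2 ^+ k :> R by rewrite exprn_gt0.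
have /andP[lo hi] := truncn_itv (mulr_ge0 s0 (ltW p0)).
rewrite exprVn ler_pdivrMr// lo andbT lerBlDr -[X in _ + X]mul1r -mulrDl natr1.
by rewrite ler_pdivlMr// ltW.
Qed.

Lemma exp_euler_bound (h : R) j s : 0 <= h -> j%:R * h <= s ->
  (1 + h * L) ^+ j <= expR (L * s).
Proof.
move=> h0 js; apply: (@le_trans _ _ (expR (j%:R * (h * L)))).
  by rewrite expRM_natl lerXn2r ?nnegrE ?expR_ge0 ?addr_ge0 ?mulr_ge0// expR_ge1Dx.
by rewrite ler_expR mulrA mulrC ler_wpM2l.
Qed.

(** Up to a factor 2, the error at time [s] of the polygon of mesh [2 ^ -k] is
[rate s * 2 ^ -k]. *)
Let rate (s : R) := M + L * M * s * expR (L * s).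

Let kappa_ge1 (h : R) : 0 <= h -> 1 <= 1 + h * L.
Proof. by move=> h0; rewrite lerDl mulr_ge0. Qed.

Let half_ge0 k : 0 <= 2^-1 ^+ k :> R.
Proof. by rewrite exprn_ge0. Qed.

(** Halving the mesh replaces each step by two half steps, a local error of order
[h ^ 2], over at most [s / h] steps; the finer grid may also have one more point
before [s]. *)
Lemma dist_euler_approxS k s x : 0 <= s ->
  `|euler_approx U k.+1 s x - euler_approx U k s x| <= rate s * 2^-1 ^+ k.
Proof.
move=> s0; rewrite /euler_approx.
set J := Num.truncn (s * 2 ^+ k); set J' := Num.truncn (s * 2 ^+ k.+1).
have p0 i : 0 <= s * 2 ^+ i by rewrite mulr_ge0// exprn_ge0.
have /andP[Jlo Jhi] := truncn_itv (p0 k); rewrite -/J in Jlo Jhi.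
have J1 : (J * 2 <= J')%N.
  by rewrite truncn_ge_nat// exprSr mulrA natrM ler_pM2r.
have J2 : (J' < (J.+1 * 2))%N.
  by rewrite truncn_lt_nat// exprSr mulrA natrM ltr_pM2r.
set h := 2^-1 ^+ k; set d := 2^-1 ^+ k.+1.
have hd : h = d * 2 by rewrite /d exprSr mulfVK.
have d0 : 0 <= d by exact: half_ge0.
have Jh : J%:R * h <= s by have /andP[] := truncn_half_pow k s0.
rewrite -(subnK J1) iterD iterM; set r := (J' - _)%N.
have r1 : r%:R <= 1 :> R.
  by rewrite -[1]/(1%:R) ler_nat /r; move: J2; rewrite mulSn; lia.
apply: le_trans (ler_distD (iter J (iter 2 (euler_step U d)) x) _ _) _.
rewrite /rate mulrDl; apply: lerD.
  apply: le_trans (dist_iter_euler_step _ _ d0) _.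
  rewrite mulrC ler_wpM2l// hd mulr_natr mulr2n.
  by rewrite (le_trans (ler_wpM2r d0 r1))// mul1r lerDl.
rewrite distrC.
have step y : `|euler_step U h y - iter 2 (euler_step U d) y| <= L * M * d ^+ 2.
  rewrite /= /euler_step hd mulr_natr mulr2n scalerDl addrA opprD addrACA subrr.
  rewrite add0r -scalerBr normrZ ger0_norm// mulrC expr2 mulrA ler_wpM2r//.
  apply: le_trans (lipU _ _) _; rewrite -mulrA ler_wpM2l//.
  rewrite opprD addNKr normrN normrZ ger0_norm// mulrC.
  by rewrite ler_wpM2r.
have LMd : 0 <= L * M * d ^+ 2 by rewrite !mulr_ge0// exprn_ge0.
apply: le_trans (dist_iter_iter (kappa_ge1 (half_ge0 k)) LMd
  (fun y z => dist_euler_step y z (half_ge0 k)) J x step) _.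
apply: (@le_trans _ _ (J%:R * expR (L * s) * (L * M * d ^+ 2))).
  rewrite ler_wpM2r// ler_wpM2l//; exact: exp_euler_bound.
rewrite [leLHS](_ : _ = (L * M * expR (L * s) * d) * (J%:R * d)); last by ring.
rewrite [leRHS](_ : _ = (L * M * expR (L * s) * h) * s); last by ring.
have LMe : 0 <= L * M * expR (L * s) by rewrite !mulr_ge0 ?expR_ge0.
have dh : d <= h by rewrite hd mulr_natr mulr2n lerDl.
apply: ler_pM; rewrite ?mulr_ge0//; first by rewrite ler_wpM2l.
by apply: le_trans Jh; rewrite ler_wpM2l.
Qed.

Lemma dist_euler_approx_semiflow k s x : 0 <= s ->
  `|euler_approx U k s x - euler_semiflow U s x| <= 2 * rate s * 2^-1 ^+ k.
Proof.
move=> s0.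
by apply: (dist_half_pow_limn (u := fun k => euler_approx U k s x)) => j;
   exact: dist_euler_approxS.
Qed.

Lemma dist_euler_approx k s x y : 0 <= s ->
  `|euler_approx U k s x - euler_approx U k s y| <= expR (L * s) * `|x - y|.
Proof.
move=> s0; apply: le_trans (dist_iter_lipschitz (kappa_ge1 (half_ge0 k))
  (fun y z => dist_euler_step y z (half_ge0 k)) _ _ _) _.
rewrite ler_wpM2r//; apply: exp_euler_bound => //.
by have /andP[] := truncn_half_pow k s0.
Qed.

Lemma euler_semiflow_lipschitz s x y : 0 <= s ->
  `|euler_semiflow U s x - euler_semiflow U s y| <= expR (L * s) * `|x - y|.
Proof.
move=> s0; apply: (@ler_half_pow _ _ _ (2 * (2 * rate s))) => k.
apply: le_trans (ler_distD (euler_approx U k s x) _ _) _.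
rewrite distrC; apply: le_trans (lerD (dist_euler_approx_semiflow _ _ s0)
  (ler_distD (euler_approx U k s y) _ _)) _.
apply: le_trans (lerD (lexx _) (lerD (dist_euler_approx _ _ _ s0)
  (dist_euler_approx_semiflow _ _ s0))) _.
by rewrite le_eqVlt; apply/orP; left; apply/eqP; ring.
Qed.

(** On the dyadic grid the semigroup law is [iterD]; rounding [s], [t] and [s + t]
down to the grid creates at most one extra step. *)
Lemma euler_semiflowD s t x : 0 <= s -> 0 <= t ->
  euler_semiflow U (s + t) x = euler_semiflow U s (euler_semiflow U t x).
Proof.
move=> s0 t0; apply/eqP; rewrite -subr_eq0 -normr_le0.
pose c := 2 * rate (s + t) + M + expR (L * s) * (2 * rate t) + 2 * rate s.
apply: (@ler_half_pow _ _ _ c) => k; rewrite add0r.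
apply: le_trans (ler_distD (euler_approx U k (s + t) x) _ _) _.
rewrite distrC /c -!addrA mulrDl.
apply: lerD; first exact/dist_euler_approx_semiflow/addr_ge0.
apply: le_trans (ler_distD (euler_approx U k s (euler_approx U k t x)) _ _) _.
rewrite mulrDl; apply: lerD.
  rewrite /euler_approx -iterD.
  set a := Num.truncn (s * _); set b := Num.truncn (t * _).
  set c' := Num.truncn _.
  have p0 (u : R) : 0 <= u -> 0 <= u * 2 ^+ k.
    by move=> u0; rewrite mulr_ge0// exprn_ge0.
  have st0 := p0 _ (addr_ge0 s0 t0).
  have /andP[alo ahi] := truncn_itv (p0 _ s0); rewrite -/a in alo ahi.
  have /andP[blo bhi] := truncn_itv (p0 _ t0); rewrite -/b in blo bhi.
  have c1 : (a + b <= c')%N by rewrite truncn_ge_nat// mulrDl natrD lerD.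
  have c2 : (c' < a.+1 + b.+1)%N by rewrite truncn_lt_nat// mulrDl natrD ltrD.
  rewrite -(subnK c1) iterD; set r := (c' - _)%N.
  have r1 : r%:R <= 1 :> R by rewrite -[1]/(1%:R) ler_nat /r; lia.
  apply: le_trans (dist_iter_euler_step _ _ (half_ge0 k)) _.
  by rewrite mulrC ler_wpM2l// ler_piMl.
apply: le_trans (ler_distD (euler_approx U k s (euler_semiflow U t x)) _ _) _.
rewrite mulrDl; apply: lerD; last exact: dist_euler_approx_semiflow.
apply: le_trans (dist_euler_approx _ _ _ s0) _.
by rewrite -mulrA ler_wpM2l ?expR_ge0// dist_euler_approx_semiflow.
Qed.

Lemma euler_semiflow_expansion s x : 0 <= s ->
  `|euler_semiflow U s x - x - s *: U x| <= L * M * s ^+ 2.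
Proof.
move=> s0; apply: (@ler_half_pow _ _ _ (2 * rate s + M)) => k.
have /andP[lo hi] := truncn_half_pow k s0.
set j := Num.truncn _ in lo hi; set h := 2^-1 ^+ k in lo hi *.
rewrite -addrA -opprD.
apply: le_trans (ler_distD (euler_approx U k s x) _ _) _.
rewrite distrC; apply: le_trans (lerD (dist_euler_approx_semiflow _ _ s0)
  (ler_distD (x + (j%:R * h) *: U x) _ _)) _.
rewrite addrCA [(2 * rate s + M) * _]mulrDl; apply: lerD; last first.
  rewrite lerD2l [x + _]addrC [x + _ *: _]addrC opprD addrACA subrr addr0.
  rewrite -scalerBl normrZ distrC ger0_norm ?subr_ge0// mulrC ler_pM ?subr_ge0//.
  by rewrite lerBlDr addrC -lerBlDr.
rewrite opprD addrA.
apply: le_trans (iter_euler_step_expansion _ _ (half_ge0 k)) _.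
by rewrite ler_wpM2l ?mulr_ge0// lerXn2r ?nnegrE ?mulr_ge0.
Qed.

Lemma euler_semiflow_zero s x : 0 <= s -> U x = 0 -> euler_semiflow U s x = x.
Proof.
move=> s0 Ux; apply/esym/eqP; rewrite -subr_eq0 -normr_le0.
apply: (@ler_half_pow _ _ _ (2 * rate s)) => k; rewrite add0r.
apply: le_trans (dist_euler_approx_semiflow k x s0).
by rewrite /euler_approx iter_fix// /euler_step Ux scaler0 addr0.
Qed.

End bounded_lipschitz_field.

(** A forward step followed by a backward one returns to the start up to an error
of order [h ^ 2], which is small compared to the number of steps. *)
Lemma euler_semiflow_inverse (U : V -> V) (L M : R) s x : 0 <= L ->
  (forall x, `|U x| <= M) -> (forall x y, `|U x - U y| <= L * `|x - y|) -> 0 <= s ->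
  euler_semiflow (fun y => - U y) s (euler_semiflow U s x) = x.
Proof.
move=> L0 boundU lipU s0.
have M0 : 0 <= M by exact: le_trans (normr_ge0 _) (boundU 0).
pose N y := - U y.
have boundN y : `|N y| <= M by rewrite normrN.
have lipN y z : `|N y - N z| <= L * `|y - z|.
  by rewrite /N -opprD normrN.
apply/eqP; rewrite -subr_eq0 -normr_le0.
pose r := M + L * M * s * expR (L * s).
pose c := 2 * r + expR (L * s) * (2 * r) + s * expR (L * s) * (L * M).
apply: (@ler_half_pow _ _ _ c) => k; rewrite add0r.
set y := euler_semiflow U s x.
apply: le_trans (ler_distD (euler_approx N k s y) _ _) _.
rewrite distrC /c -addrA mulrDl; apply: lerD.
  exact: (dist_euler_approx_semiflow L0 boundN lipN).
apply: le_trans (ler_distD (euler_approx N k s (euler_approx U k s x)) _ _) _.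
rewrite mulrDl; apply: lerD.
  apply: le_trans (dist_euler_approx L0 lipN _ _ _ s0) _.
  rewrite -mulrA ler_wpM2l ?expR_ge0// distrC.
  exact: (dist_euler_approx_semiflow L0 boundU lipU).
set h := 2^-1 ^+ k.
have h0 : 0 <= h by rewrite exprn_ge0.
have /andP[_ jh] := truncn_half_pow k s0; rewrite -/h in jh.
have step z : `|euler_step N h (euler_step U h z) - z| <= L * M * h ^+ 2.
  rewrite /euler_step /N scalerN addrAC [z + _ - _]addrAC subrr add0r -scalerBr.
  rewrite normrZ ger0_norm// mulrC expr2 mulrA ler_wpM2r//.
  apply: le_trans (lipU _ _) _; rewrite -mulrA ler_wpM2l//.
  by rewrite opprD addNKr normrN normrZ ger0_norm// mulrC ler_wpM2r.
have LMh : 0 <= L * M * h ^+ 2 by rewrite !mulr_ge0// exprn_ge0.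
have kappa1 : 1 <= 1 + h * L by rewrite lerDl mulr_ge0.
apply: le_trans (dist_iter_inverse kappa1 LMh
  (fun y z => dist_euler_step lipN y z h0) _ x step) _.
apply: (@le_trans _ _ ((Num.truncn (s * 2 ^+ k))%:R * expR (L * s) * (L * M * h ^+ 2))).
  by rewrite ler_wpM2r// ler_wpM2l//; exact: exp_euler_bound.
rewrite [leLHS](_ : _ =
  expR (L * s) * (L * M) * h * ((Num.truncn (s * 2 ^+ k))%:R * h)); last by ring.
rewrite [leRHS](_ : _ = expR (L * s) * (L * M) * h * s); last by ring.
by rewrite ler_wpM2l// !mulr_ge0// expR_ge0.
Qed.

End euler.

Definition euler_flow {R : realType} {V : completeNormedModType R} (U : V -> V)
    (s : R) (x : V) : V :=
  if 0 <= s then euler_semiflow U s x else euler_semiflow (fun y => - U y) (- s) x.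

Section flow.
Context {R : realType} {V : completeNormedModType R}.
Variables (U : V -> V) (L M : R).
Hypotheses (L0 : 0 <= L) (boundU : forall x, `|U x| <= M)
  (lipU : forall x y, `|U x - U y| <= L * `|x - y|).

Let boundN y : `|- U y| <= M. Proof. by rewrite normrN. Qed.

Let lipN y z : `|- U y - - U z| <= L * `|y - z|.
Proof. by rewrite -opprD normrN. Qed.

Lemma euler_flow_lipschitz s x y :
  `|euler_flow U s x - euler_flow U s y| <= expR (L * `|s|) * `|x - y|.
Proof.
rewrite /euler_flow; case: ifPn => s0.
  by rewrite ger0_norm//; exact: (euler_semiflow_lipschitz L0 boundU lipU).
rewrite -ltNge in s0; rewrite ltr0_norm//.
by apply: (euler_semiflow_lipschitz L0 boundN lipN); rewrite oppr_ge0 ltW.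
Qed.

Lemma euler_flow_expansion s x :
  `|euler_flow U s x - x - s *: U x| <= L * M * s ^+ 2.
Proof.
rewrite /euler_flow; case: ifPn => s0.
  exact: (euler_semiflow_expansion L0 boundU lipU).
rewrite -ltNge in s0; have := euler_semiflow_expansion L0 boundN lipN x (s := - s).
by rewrite oppr_ge0 sqrrN scalerN scaleNr opprK; apply; exact: ltW.
Qed.

Lemma euler_flow_zero s x : U x = 0 -> euler_flow U s x = x.
Proof.
move=> Ux; rewrite /euler_flow; case: ifPn => s0.
  exact: (euler_semiflow_zero L0 boundU lipU).
rewrite -ltNge in s0; apply: (euler_semiflow_zero L0 boundN lipN).
  by rewrite oppr_ge0 ltW.
by rewrite Ux oppr0.
Qed.

Lemma euler_flow0 x : euler_flow U 0 x = x.
Proof.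
apply/eqP; rewrite -subr_eq0 -normr_le0.
have := euler_flow_expansion 0 x.
by rewrite scale0r subr0 expr0n mulr0.
Qed.

Lemma euler_flowK s x : euler_flow U (- s) (euler_flow U s x) = x.
Proof.
rewrite /euler_flow oppr_ge0 opprK; case: (ltrgt0P s) => s0.
- exact: (euler_semiflow_inverse x L0 boundU lipU (ltW s0)).
- have ns0 : 0 <= - s by rewrite oppr_ge0 ltW.
  rewrite -[RHS](euler_semiflow_inverse x L0 boundN lipN ns0).
  by congr euler_semiflow; apply/funext => y; rewrite opprK.
- by have := euler_flow0; rewrite /euler_flow lexx s0 oppr0 => p; rewrite !p.
Qed.

Let euler_flowD_same_sign s t x : (0 <= s) && (0 <= t) || (s <= 0) && (t <= 0) ->
  euler_flow U (s + t) x = euler_flow U s (euler_flow U t x).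
Proof.
have [->|s0] := eqVneq s 0; first by rewrite add0r euler_flow0.
have [->|t0] := eqVneq t 0; first by rewrite addr0 euler_flow0.
case/orP => /andP[ss tt]; rewrite /euler_flow.
  by rewrite ss tt addr_ge0//; exact: (euler_semiflowD L0 boundU lipU).
have {}ss : s < 0 by rewrite lt_neqAle s0.
have {}tt : t < 0 by rewrite lt_neqAle t0.
rewrite !leNgt ss tt ltr_nDl//= opprD.
by apply: (euler_semiflowD L0 boundN lipN); rewrite oppr_ge0 ltW.
Qed.

Lemma euler_flowD s t x :
  euler_flow U (s + t) x = euler_flow U s (euler_flow U t x).
Proof.
have [st|st] := boolP ((0 <= s) && (0 <= t) || (s <= 0) && (t <= 0)).
  exact: euler_flowD_same_sign.
(* When the signs differ, [s + t] has the sign of [- t] or that of [- s]; split [s],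
respectively [t], into two times of equal sign. *)
have split_s : (0 <= s + t) && (t <= 0) || (s + t <= 0) && (0 <= t) ->
    euler_flow U (s + t) x = euler_flow U s (euler_flow U t x).
  move=> h; rewrite -{2}(addrK t s) (@euler_flowD_same_sign (s + t) (- t)).
    by rewrite euler_flowK.
  by rewrite oppr_ge0 oppr_le0.
have split_t : (0 <= s + t) && (s <= 0) || (s + t <= 0) && (0 <= s) ->
    euler_flow U (s + t) x = euler_flow U s (euler_flow U t x).
  move=> h; rewrite -{2}(addKr s t) (@euler_flowD_same_sign (- s) (s + t)).
    by rewrite -{2}[s]opprK euler_flowK.
  by rewrite oppr_ge0 oppr_le0; case/orP: h => /andP[-> ->]; rewrite ?orbT.
have [s0|s0] := leP 0 s; have [t0|t0] := leP 0 t.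
- by rewrite s0 t0 in st.
- have [st0|st0] := leP 0 (s + t).
    by apply: split_s; rewrite st0 (ltW t0).
  by apply: split_t; rewrite s0 (ltW st0) orbT.
- have [st0|st0] := leP 0 (s + t).
    by apply: split_t; rewrite st0 (ltW s0).
  by apply: split_s; rewrite t0 (ltW st0) orbT.
- by rewrite (ltW s0) (ltW t0) orbT in st.
Qed.

End flow.

(** * Riemann-Stieltjes sums and remainders *)

Section riemann_stieltjes.
Context {R : realType}.

(** Riemann-Stieltjes sums over [[a, b]] of mesh less than [delta], with [b] before
[a] because only the left end point varies in the recursion.  The inductive form,
in contrast with lists of points and tags, makes concatenating partitions an
induction of one line. *)
Inductive RS_sum (f g : R -> R) (delta b : R) : R -> R -> Prop :=
| RS_sum_nil : RS_sum f g delta b b 0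
| RS_sum_cons a c xi S : a < c -> c - a < delta -> a <= xi <= c ->
    RS_sum f g delta b c S -> RS_sum f g delta b a (f xi * (g c - g a) + S).

Variables (f g : R -> R).

Lemma RS_sum_partition delta a b S : RS_sum f g delta b a S ->
  exists (s : seq R) (xi : nat -> R),
    [/\ itv_partition a b s,
      forall i, (i < size s)%N ->
        let x := nth b (a :: s) in x i.+1 - x i < delta /\ x i <= xi i <= x i.+1 &
      S = \sum_(i < size s) f (xi i) *
            (g (nth b (a :: s) i.+1) - g (nth b (a :: s) i))].
Proof.
elim=> [|{}a c x0 {}S ac acd acx _ [s [xi [[ps ls] fine ->]]]].
  by exists [::], (fun=> 0); split => //; rewrite big_ord0.
exists (c :: s), (fun i => if i is j.+1 then xi j else x0); split.
- by split => //=; rewrite ac.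
- by case=> [|i] //=; rewrite ltnS => /fine.
- by rewrite big_ord_recl.
Qed.

Lemma RS_sum_cat delta a b c S S' : RS_sum f g delta b a S ->
  RS_sum f g delta c b S' -> RS_sum f g delta c a (S + S').
Proof.
move=> sumab sumbc; elim: sumab; first by rewrite add0r.
by move=> {}a d xi {}S ad add axi _ IH; rewrite -addrA; exact: RS_sum_cons.
Qed.

Lemma RS_sum_le delta delta' a b S : delta <= delta' ->
  RS_sum f g delta b a S -> RS_sum f g delta' b a S.
Proof.
move=> dd'; elim=> [|{}a c xi {}S ac acd axi _ IH]; first exact: RS_sum_nil.
by apply: RS_sum_cons => //; exact: lt_le_trans acd _.
Qed.

Lemma RS_sum_exists delta a b : 0 < delta -> a <= b ->
  exists S, RS_sum f g delta b a S.
Proof.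
move=> d0.
have [k] : exists k : nat, b - a <= k%:R * (delta / 2).
  exists (Num.truncn ((b - a) / (delta / 2))).+1.
  by rewrite -ler_pdivrMr ?divr_gt0// ltW// truncnS_gt.
elim: k a => [|k IH] a.
  rewrite mul0r subr_le0 => ba ab; have -> : a = b by apply/le_anti; rewrite ab.
  by exists 0; exact: RS_sum_nil.
move=> bak ab; have [bad|bad] := ltP (b - a) delta.
  have [->|neq] := eqVneq a b; first by exists 0; exact: RS_sum_nil.
  eexists; apply: (@RS_sum_cons _ _ _ _ _ b a) => //; last exact: RS_sum_nil.

    by rewrite lt_neqAle neq.
  by rewrite lexx.
have [||S sumS] := IH (a + delta / 2); [|lra|].
  by move: bak; rewrite -natr1 mulrDl mul1r; lra.
eexists; apply: (@RS_sum_cons _ _ _ _ _ (a + delta / 2) a) sumS; lra.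
Qed.

Lemma is_RS_integral_sum a b I : is_RS_integral f g a b I ->
  forall eps : R, 0 < eps -> exists2 delta, 0 < delta &
  forall S, RS_sum f g delta b a S -> `|S - I| < eps.
Proof.
move=> fgI eps eps0; have [delta d0 near_I] := fgI _ eps0.
exists delta => // S /RS_sum_partition[s [xi [ps fine ->]]].
exact: near_I.
Qed.

Variable J : R -> R.
Hypothesis fgJ : forall t, 0 <= t -> is_RS_integral f g 0 t (J t).

(** A fine sum over [[a, b]] is the difference of fine sums over [[0, b]] and
[[0, a]]. *)
Lemma RS_integral_additive a b eps : 0 <= a -> a <= b -> 0 < eps ->
  exists2 delta, 0 < delta &
  forall S, RS_sum f g delta b a S -> `|S - (J b - J a)| < eps.
Proof.
move=> a0 ab eps0; have e2 : 0 < eps / 2 by rewrite divr_gt0.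
have [d1 d10 near_a] := is_RS_integral_sum (fgJ a0) e2.
have [d2 d20 near_b] := is_RS_integral_sum (fgJ (le_trans a0 ab)) e2.
exists (Num.min d1 d2); first by rewrite lt_min d10.
move=> S sumS.
have [||S0 sumS0] := @RS_sum_exists (Num.min d1 d2) 0 a; rewrite ?lt_min ?d10//.
have Ia : `|S0 - J a| < eps / 2.
  by apply: near_a; apply: RS_sum_le sumS0; rewrite ge_min lexx.
have Ib : `|S0 + S - J b| < eps / 2.
  apply: near_b; apply: RS_sum_le (RS_sum_cat sumS0 sumS).
  by rewrite ge_min lexx orbT.
rewrite (_ : _ - _ = (S0 + S - J b) - (S0 - J a)); last by ring.
by apply: le_lt_trans (ler_normB _ _) _; rewrite [ltRHS]splitr ltrD.
Qed.

Definition RS_remainder (s t : R) : R := J t - J s - f s * (g t - g s).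

(** The intervals on which [sg] times the remainder is nonnegative are kept; each
of the others is refined until its sum is within [eta] of the integral.  The
resulting sum differs from the integral by the kept remainders only, so these
add up to no more than the error of a single Riemann-Stieltjes sum. *)
Let signed_remainders sg delta eta (t : nat -> R) N :
  `|sg| = 1 -> 0 < delta -> 0 < eta -> 0 <= t 0%N ->
  (forall k, t k < t k.+1) -> (forall k, t k.+1 - t k < delta) ->
  exists2 S, RS_sum f g delta (t N) (t 0%N) S &
    \sum_(k < N) Num.max 0 (sg * RS_remainder (t k) (t k.+1)) - N%:R * eta
    <= sg * (J (t N) - J (t 0%N) - S).
Proof.
move=> sg1 d0 eta0 t0 tS td.
have t_ge0 k : 0 <= t k by elim: k => // k /le_trans; apply; exact: ltW.
elim: N => [|N [S sumS boundS]].
  exists 0; first exact: RS_sum_nil.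
  by rewrite big_ord0 mul0r !subrr mulr0.
suff [S' sumS' boundS'] : exists2 S', RS_sum f g delta (t N.+1) (t N) S' &
    Num.max 0 (sg * RS_remainder (t N) (t N.+1)) - eta
    <= sg * (J (t N.+1) - J (t N) - S').
  exists (S + S'); first exact: RS_sum_cat sumS sumS'.
  rewrite big_ord_recr /= -[N.+1]addn1 natrD mulrDl mul1r addn1.
  rewrite opprD addrACA; apply: le_trans (lerD boundS boundS') _.
  by rewrite le_eqVlt; apply/orP; left; apply/eqP; ring.
have [pos|neg] := leP 0 (sg * RS_remainder (t N) (t N.+1)).
  exists (f (t N) * (g (t N.+1) - g (t N)) + 0).
    by apply: RS_sum_cons => //; [rewrite lexx ltW|exact: RS_sum_nil].
  by rewrite addr0 gerBl ltW.
have [d' d'0 near_J] := RS_integral_additive (t_ge0 N) (ltW (tS N)) eta0.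
have [||S' sumS'] := @RS_sum_exists (Num.min delta d') (t N) (t N.+1).
- by rewrite lt_min d0.
- exact: ltW.
exists S'; first by apply: RS_sum_le sumS'; rewrite ge_min lexx.
rewrite add0r lerNl -mulrN opprB; apply: le_trans (ler_norm _) _.
rewrite normrM sg1 mul1r ltW//; apply: near_J.
by apply: RS_sum_le sumS'; rewrite ge_min lexx orbT.
Qed.

(** Remainders of a given sign cannot cancel, and both signs are controlled by
[signed_remainders]; hence the bound on the sum of absolute values. *)
Lemma sum_RS_remainder_le a b eps : 0 <= a -> a <= b -> 0 < eps ->
  exists2 delta, 0 < delta & forall N (t : nat -> R), t 0%N = a -> t N = b ->
    (forall k, t k < t k.+1) -> (forall k, t k.+1 - t k < delta) ->
    \sum_(k < N) `|RS_remainder (t k) (t k.+1)| <= eps.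
Proof.
move=> a0 ab eps0; have e2 : 0 < eps / 2 by rewrite divr_gt0.
have [delta d0 near_J] := RS_integral_additive a0 ab e2.
exists delta => // N t ta tb tS td.
have half sg : `|sg| = 1 ->
    \sum_(k < N) Num.max 0 (sg * RS_remainder (t k) (t k.+1)) <= eps / 2.
  move=> sg1; apply/ler_addgt0Pr => e e0.
  have eta0 : 0 < e / N.+1%:R by rewrite divr_gt0.
  have t0 : 0 <= t 0%N by rewrite ta.
  have [S sumS] := signed_remainders N sg1 d0 eta0 t0 tS td.
  rewrite lerBlDr => /le_trans; apply; apply: lerD.
    apply: le_trans (ler_norm _) _; rewrite normrM sg1 mul1r distrC.
    by rewrite tb ta in sumS *; exact/ltW/near_J.
  rewrite mulrCA ler_piMr ?(ltW e0)// ler_pdivrMr// mul1r ler_nat//.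
rewrite [leRHS]splitr.
apply: le_trans (lerD (half 1 (normr1 _)) (half (-1) (normrN1 _))).
rewrite -big_split /=; apply: ler_sum => k _; rewrite mul1r mulN1r.
set r := RS_remainder _ _.
have [p1 p2] : 0 <= Num.max 0 r /\ r <= Num.max 0 r by rewrite !le_max !lexx orbT.
have [p3 p4] : 0 <= Num.max 0 (- r) /\ - r <= Num.max 0 (- r).
  by rewrite !le_max !lexx orbT.
by rewrite ler_norml; lra.
Qed.

End riemann_stieltjes.

(** * Solutions of the integral equation follow the flow *)

Section uniform_partition.
Context {R : realType}.

Definition uniform_point (a b : R) (N k : nat) : R := a + k%:R * ((b - a) / N%:R).

Variables (a b : R) (N : nat).
Hypotheses (ab : a < b) (N0 : (0 < N)%N).

Let mesh0 : 0 < (b - a) / N%:R. Proof. by rewrite divr_gt0 ?subr_gt0 ?ltr0n. Qed.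

Lemma uniform_point0 : uniform_point a b N 0 = a.
Proof. by rewrite /uniform_point mul0r addr0. Qed.

Lemma uniform_point_last : uniform_point a b N N = b.
Proof. by rewrite /uniform_point mulrC divfK ?pnatr_eq0 -?lt0n// addrC subrK. Qed.

Lemma uniform_pointS k :
  uniform_point a b N k.+1 - uniform_point a b N k = (b - a) / N%:R.
Proof. by rewrite /uniform_point -natr1; ring. Qed.

Lemma uniform_point_lt k : uniform_point a b N k < uniform_point a b N k.+1.
Proof. by rewrite -subr_gt0 uniform_pointS. Qed.

Lemma uniform_point_itv k : (k <= N)%N -> a <= uniform_point a b N k <= b.
Proof.
move=> kN; rewrite lerDl mulr_ge0 ?(ltW mesh0)//= -[leRHS]uniform_point_last lerD2l.
by rewrite ler_pM2r// ler_nat.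
Qed.

End uniform_partition.

Lemma norm_telescope_le {R : realType} {V : normedModType R} (z : nat -> V) N :
  `|z N - z 0%N| <= \sum_(k < N) `|z k.+1 - z k|.
Proof.
elim: N => [|N IH]; first by rewrite subrr normr0 big_ord0.
rewrite big_ord_recr /= addrC; apply: le_trans (ler_distD (z N) _ _) _.
exact: lerD.
Qed.

Section doss_sussmann.
Context {R : realType} {V : completeNormedModType R}.
Variables (U : V -> V) (L M : R).
Hypotheses (L0 : 0 <= L) (boundU : forall x, `|U x| <= M)
  (lipU : forall x y, `|U x - U y| <= L * `|x - y|).
Variables (g : R -> R) (x : R -> V).
Hypotheses (cg : continuous g) (cx : continuous x).

Let increment a b N k : V :=
  x (uniform_point a b N k.+1) - x (uniform_point a b N k).
Let gincrement a b N k : R :=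
  g (uniform_point a b N k.+1) - g (uniform_point a b N k).
Let remainder a b N k : V :=
  increment a b N k - gincrement a b N k *: U (x (uniform_point a b N k)).

(* For the driven equation, the first hypothesis follows from the existence of the
integral of [U x] against [g] on every interval, and the second one from the
Hoelder continuity of [x] of order greater than 1/2. *)
Hypothesis remainders_small : forall a b eps : R, 0 <= a -> a < b -> 0 < eps ->
  \forall N \near \oo, \sum_(k < N) `|remainder a b N k| <= eps.
Hypothesis squares_small : forall a b eps : R, 0 <= a -> a < b -> 0 < eps ->
  \forall N \near \oo, \sum_(k < N) `|increment a b N k| ^+ 2 <= eps.

Let M0 : 0 <= M. Proof. exact: le_trans (normr_ge0 _) (boundU 0). Qed.

Lemma dist_euler_flow_time s t y :
  `|euler_flow U s y - euler_flow U t y| <= (M + L * M * `|s - t|) * `|s - t|.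
Proof.
rewrite -{1}(subrK t s) (euler_flowD L0 boundU lipU).
set z := euler_flow U t y; set h := s - t.
have := euler_flow_expansion L0 boundU lipU h z.
rewrite -real_normK ?num_real// => bd.
rewrite -(subrK (h *: U z) (_ - z)); apply: le_trans (ler_normD _ _) _.
rewrite mulrDl addrC; apply: lerD; last by rewrite -mulrA -expr2.
by rewrite normrZ mulrC ler_wpM2r.
Qed.

Lemma continuous_euler_flow_time y : continuous (fun s => euler_flow U s y).
Proof.
move=> s; apply/cvgrPdist_le => e e0.
have LM0 : 0 <= L * M by exact: mulr_ge0.
have K0 : 0 < M + L * M + 1 by rewrite ltr_wpDl// addr_ge0.
have d0 : 0 < e / (M + L * M + 1) by exact: divr_gt0.
near=> t; apply: le_trans (dist_euler_flow_time _ _ _) _.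
have st1 : `|s - t| <= 1.
  by near: t; apply: (@cvgr_dist_le _ _ _ (nbhs s) _ id) => //; exact: cvg_id.
have ste : `|s - t| <= e / (M + L * M + 1).
  near: t; apply: (@cvgr_dist_le _ _ _ (nbhs s) _ id) => //; exact: cvg_id.
apply: (@le_trans _ _ ((M + L * M + 1) * `|s - t|)); last first.
  by rewrite mulrC -ler_pdivlMr.
rewrite ler_wpM2r// -addrA lerD2l; apply: (@le_trans _ _ (L * M)).
  by rewrite ler_piMr.
by rewrite lerDl.
Unshelve. all: by end_near. Qed.

(** Pulling the path back by the flow gives [z], whose increments are at most
[K (|R_k| + L M |g_(t_(k+1)) - g_(t_k)| ^ 2)]; the lower bound on [U] turns the
increments of [g] into increments of [x]. *)
Lemma solution_flow_nondegenerate a b c : 0 <= a -> a < b -> 0 < c ->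
  (forall t, a <= t <= b -> c <= `|U (x t)|) ->
  x b = euler_flow U (g b - g a) (x a).
Proof.
move=> a0 ab c0 cU.
have [G boundG] : exists G, forall t, a <= t <= b -> `|g t| <= G.
  have [|t0 _ gt0] := @EVT_max R (fun t => `|g t|) _ _ (ltW ab).
    by apply: continuous_subspaceT => t; apply: cvg_norm; exact: cg.
  by exists `|g t0| => t tab; exact: gt0.
have G0 : 0 <= G by apply: le_trans (normr_ge0 _) (boundG a _); rewrite lexx ltW.
pose K := expR (L * (G + G)); have K0 : 0 < K by exact: expR_gt0.
pose z N k :=
  euler_flow U (g a - g (uniform_point a b N k)) (x (uniform_point a b N k)).
pose D := L * M / c ^+ 2 * 2.
have D0 : 0 <= D by rewrite !mulr_ge0// invr_ge0 exprn_ge0 ?ltW.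
suff zconst : euler_flow U (g a - g b) (x b) = x a.
  rewrite -zconst -(euler_flowD L0 boundU lipU) addrA subrK subrr.
  by rewrite (euler_flow0 L0 boundU lipU).
apply/eqP; rewrite -subr_eq0 -normr_le0; apply/ler_addgt0Pr => e e0; rewrite add0r.
pose C := K * (1 + D + D).
have C0 : 0 < C by rewrite mulr_gt0// -addrA ltr_wpDr// addr_ge0.
(* The bound 1 makes [|R_k| ^ 2 <= |R_k|] available below. *)
pose e' := Num.min 1 (e / C).
have e'0 : 0 < e' by rewrite lt_min ltr01 divr_gt0.
near \oo => N.
have N0 : (0 < N)%N by near: N; exact: nbhs_infty_gt.
have Rsmall : \sum_(k < N) `|remainder a b N k| <= e'.
  by near: N; exact: remainders_small.
have Qsmall : \sum_(k < N) `|increment a b N k| ^+ 2 <= e'.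
  by near: N; exact: squares_small.
have -> : euler_flow U (g a - g b) (x b) - x a = z N N - z N 0%N.
  rewrite /z uniform_point_last// uniform_point0// subrr.
  by rewrite (euler_flow0 L0 boundU lipU).
apply: le_trans (norm_telescope_le _ _) _.
apply: (@le_trans _ _ (\sum_(k < N)
    K * ((1 + D) * `|remainder a b N k| + D * `|increment a b N k| ^+ 2))); last first.
  rewrite -mulr_sumr big_split /= -!mulr_sumr.
  apply: (@le_trans _ _ (K * ((1 + D) * e' + D * e'))).
    by rewrite ler_pM2l// lerD// ler_wpM2l// addr_ge0.
  rewrite -mulrDl mulrA -/C mulrC -ler_pdivlMr// ge_min lexx orbT//.
apply: ler_sum => k _.
set r := remainder a b N k in Rsmall *; set dx := increment a b N k.
have r1 : `|remainder a b N k| <= 1.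
  apply: (@le_trans _ _ e'); last by rewrite ge_min lexx.
  apply: le_trans Rsmall; rewrite (bigD1 k)//= lerDl; exact: sumr_ge0.
set s := uniform_point a b N k; set t := uniform_point a b N k.+1.
have sab : a <= s <= b by apply: uniform_point_itv => //; exact: ltnW.
have tab : a <= t <= b by exact: uniform_point_itv.
rewrite /z -/s -/t.
have -> : euler_flow U (g a - g s) (x s) =
    euler_flow U (g a - g t) (euler_flow U (g t - g s) (x s)).
  by rewrite -(euler_flowD L0 boundU lipU) addrA subrK.
apply: le_trans (euler_flow_lipschitz L0 boundU lipU _ _ _) _.
apply: ler_pM; rewrite ?expR_ge0//.
  rewrite ler_expR ler_wpM2l//; apply: le_trans (ler_normB _ _) _.
  by apply: lerD; apply: boundG => //; rewrite lexx ltW.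
have dg : `|g t - g s| ^+ 2 <= (`|dx| ^+ 2 + `|r|) * 2 / c ^+ 2.
  rewrite ler_pdivlMr ?exprn_gt0// -exprMn.
  have h : `|g t - g s| * c <= `|dx| + `|r|.
    apply: (@le_trans _ _ `|(g t - g s) *: U (x s)|).
      by rewrite normrZ ler_wpM2l// cU.
    rewrite -(_ : dx - r = (g t - g s) *: U (x s)); last first.
      by rewrite /r /remainder opprB addrC subrK.
    exact: ler_normB.
  apply: (@le_trans _ _ ((`|dx| + `|r|) ^+ 2)).
    by rewrite lerXn2r ?nnegrE ?addr_ge0 ?mulr_ge0 ?(ltW c0).
  have : 0 <= (`|dx| - `|r|) ^+ 2 by exact: sqr_ge0.
  have : `|r| ^+ 2 <= `|r| by rewrite expr2 ler_piMr.
  by rewrite sqrrB sqrrD; lra.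
have fe := euler_flow_expansion L0 boundU lipU (g t - g s) (x s).
rewrite (_ : x t - _ =
  r - (euler_flow U (g t - g s) (x s) - x s - (g t - g s) *: U (x s))); last first.
  rewrite /r /remainder /increment /gincrement -/s -/t !opprB.
  by rewrite addrA subrK addrA subrK.
apply: le_trans (ler_normB _ _) _.
rewrite [(1 + D) * _]mulrDl mul1r -[leRHS]addrA lerD2l.
apply: le_trans fe _.
rewrite -real_normK ?num_real//.
apply: le_trans (ler_wpM2l (mulr_ge0 L0 M0) dg) _.
by rewrite le_eqVlt /D; apply/orP; left; apply/eqP; ring.
Unshelve. all: by end_near. Qed.

Lemma continuous_field : continuous (U \o x).
Proof.
move=> t; apply/cvgrPdist_le => e e0.
have d0 : 0 < e / (L + 1) by rewrite divr_gt0// ltr_wpDl.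
near=> u; apply: le_trans (lipU _ _) _.
have xtu : `|x t - x u| <= e / (L + 1).
  by near: u; apply: cvgr_dist_le => //; exact: cx.
apply: (@le_trans _ _ ((L + 1) * `|x t - x u|)); first by rewrite ler_wpM2r// lerDl.
by rewrite mulrC -ler_pdivlMr// ltr_wpDl.
Unshelve. all: by end_near. Qed.

Lemma solution_flow_nonzero a b : 0 <= a -> a <= b ->
  (forall t, a <= t <= b -> U (x t) != 0) ->
  x b = euler_flow U (g b - g a) (x a).
Proof.
move=> a0; rewrite le_eqVlt => /predU1P[->|ab] Unz.
  by rewrite subrr (euler_flow0 L0 boundU lipU).
have [|c cab cmin] := @EVT_min R (fun t => `|U (x t)|) _ _ (ltW ab).
  by apply: continuous_subspaceT => t; apply: cvg_norm; exact: continuous_field.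
apply: (@solution_flow_nondegenerate a b `|U (x c)|) => //.
by rewrite normr_gt0 Unz.
Qed.

Lemma solution_flow_nonzero_sym a b : 0 <= a -> 0 <= b ->
  (forall t, Num.min a b <= t <= Num.max a b -> U (x t) != 0) ->
  x b = euler_flow U (g b - g a) (x a).
Proof.
move=> a0 b0; case: (leP a b) => [ab|/ltW ba] Unz; first exact: solution_flow_nonzero.
rewrite (solution_flow_nonzero b0 ba Unz) -[g b - g a]opprB.
by rewrite (euler_flowK L0 boundU lipU).
Qed.

Lemma first_zero (k : R -> V) : continuous k -> k 1 = 0 ->
  exists2 u, 0 <= u <= 1 /\ k u = 0 & forall v, 0 <= v < u -> k v != 0.
Proof.
move=> ck k1; pose Z := `[0, 1]%classic `&` k @^-1` [set 0].
have cZ : compact Z.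
  apply: (subclosed_compact _ (@segment_compact R 0 1)) => [|u []//].
  apply: closedI; first exact: interval_closed.
  apply: closed_comp => [u _|]; first exact: ck.
  exact/accessible_closed_set1/hausdorff_accessible/norm_hausdorff.
have Z0 : Z !=set0 by exists 1; split => //=; rewrite in_itv /= ler01 lexx.
have cid : {within Z, continuous (@id R)}.
  by apply: continuous_subspaceT => u; exact: cvg_id.
have [u /set_mem[/= + ku] umin] := compact_EVT_min Z0 cZ cid.
rewrite in_itv /= => u01; exists u => // v /andP[v0 vu].
apply/eqP => kv; have := umin v; rewrite leNgt vu => /(_ _)/negP; apply => //.
apply/mem_set; split => //=; rewrite in_itv /= v0.
by case/andP: u01 => _; apply: le_trans; exact: ltW.
Qed.

(** Travel from [t] to [s] along the affine parametrisation [p], whatever the order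
of [s] and [t], and stop at the first zero [u] of the field.  Before [u] the path
is [phi (g (p v) - g t) (x t)], hence also at [u] by continuity; but the rest
point [x (p u)] is fixed by [phi], so [x t = x (p u)]. *)
Lemma zero_everywhere s t : 0 <= s -> 0 <= t -> U (x s) = 0 -> U (x t) = 0.
Proof.
move=> s0 t0 Us; have [//|Ut] := eqVneq (U (x t)) 0.
pose p u := t + u * (s - t).
have p_ge0 u : 0 <= u <= 1 -> 0 <= p u.
  case/andP=> u0 u1; rewrite /p (_ : _ + _ = (1 - u) * t + u * s); last by ring.
  by rewrite addr_ge0// mulr_ge0// subr_ge0.
have cp : continuous p.
  move=> u; apply: cvgD; first exact: cvg_cst.
  by apply: cvgM; [exact: cvg_id|exact: cvg_cst].
have ck : continuous (U \o x \o p).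
  by move=> u; apply: continuous_comp; [exact: cp|exact: continuous_field].
have [|u [u01 Uu] before] := first_zero ck.
  by rewrite /= /p mul1r addrCA subrr addr0.
have /andP[u0 u1] := u01.
have {}u0 : 0 < u.
  rewrite lt_neqAle u0 andbT; apply/eqP => u_0; move: Uu.
  by rewrite /= /p -u_0 mul0r addr0; apply/eqP.
pose D v := x (p v) - euler_flow U (g (p v) - g t) (x t).
have D0 v : 0 <= v < u -> D v = 0.
  case/andP=> v0 vu; apply/eqP; rewrite subr_eq0; apply/eqP.
  apply: solution_flow_nonzero_sym => //.
    by rewrite p_ge0// v0 (le_trans (ltW vu)).
  move=> r rpt.
  have [w /andP[w0 wv] ->] : exists2 w, 0 <= w <= v & r = p w.
    move: rpt; rewrite /p; have [ts|st|->] := ltrgtP t s.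
    - have vs0 : 0 <= v * (s - t) by rewrite mulr_ge0// subr_ge0 ltW.
      rewrite min_l ?max_r ?lerDl// => /andP[tr rp].
      exists ((r - t) / (s - t)); last by rewrite divfK ?subr_eq0 ?gt_eqF// addrC subrK.
      by rewrite divr_ge0 ?subr_ge0 ?(ltW ts)// ler_pdivrMr ?subr_gt0// lerBlDl.
    - have vs0 : v * (s - t) <= 0 by rewrite mulr_ge0_le0// subr_le0 ltW.
      rewrite min_r ?max_l ?gerDl// => /andP[pr rt].
      exists ((t - r) / (t - s)); last first.
        by rewrite -[s - t]opprB mulrN divfK ?subr_eq0 ?gt_eqF// opprB addrC subrK.
      rewrite divr_ge0 ?subr_ge0 ?(ltW st)//= ler_pdivrMr ?subr_gt0//.
      by rewrite lerBlDl -lerBlDr -mulrN opprB.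
    - rewrite subrr mulr0 addr0 minxx maxxx => rs; exists 0; first by rewrite lexx.
      by rewrite mul0r addr0; apply/le_anti; rewrite andbC.
  by apply: before; rewrite w0 (le_lt_trans wv).
have cD : continuous D.
  move=> v; apply: cvgB.
    by apply: (@continuous_comp _ _ _ p x); [exact: cp|exact: cx].
  apply: (@continuous_comp _ _ _
    (fun v => g (p v) - g t) (fun s => euler_flow U s (x t))).
    apply: cvgB; last exact: cvg_cst.
    by apply: (@continuous_comp _ _ _ p g); [exact: cp|exact: cg].
  exact: continuous_euler_flow_time.
have : D u = 0.
  have Dl : D v @[v --> u^'-] --> D u by apply: cvg_at_left_filter; exact: cD.
  rewrite -(cvg_lim _ Dl)//; apply: cvg_lim => //.
  apply: cvg_near_cst; near=> v; apply: D0; apply/andP; split.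
    by near: v; exact: nbhs_left_ge.
  by near: v; exact: nbhs_left_lt.
move/eqP; rewrite subr_eq0 => /eqP xu.
have := euler_flowK L0 boundU lipU (g (p u) - g t) (x t).
rewrite -xu (euler_flow_zero L0 boundU lipU) => [xt|//].
by move: Ut; rewrite -xt -[U _]/((U \o x \o p) u) Uu eqxx.
Unshelve. all: by end_near. Qed.

Lemma solution_is_flow t : 0 <= t -> x t = euler_flow U (g t - g 0) (x 0).
Proof.
move=> t0; have [U0|U0] := eqVneq (U (x 0)) 0; last first.
  apply: solution_flow_nonzero => // s /andP[s0 _].
  by apply/eqP => Us; move/eqP: U0; apply; exact: zero_everywhere Us.
rewrite (euler_flow_zero L0 boundU lipU)//.
have [->//|tn0] := eqVneq t 0.
have {}t0 : 0 < t by rewrite lt_neqAle eq_sym tn0.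
apply/eqP; rewrite -subr_eq0 -normr_le0; apply/ler_addgt0Pr => e e0; rewrite add0r.
near \oo => N.
have N0 : (0 < N)%N by near: N; exact: nbhs_infty_gt.
have Rsmall : \sum_(k < N) `|remainder 0 t N k| <= e.
  by near: N; exact: remainders_small.
have := norm_telescope_le (fun k => x (uniform_point 0 t N k)) N.
rewrite uniform_point_last// uniform_point0// => /le_trans; apply.
apply: le_trans Rsmall; apply: ler_sum => k _; rewrite /remainder.
suff -> : U (x (uniform_point 0 t N k)) = 0 by rewrite scaler0 subr0.
apply: zero_everywhere U0 => //.
by have /andP[] := uniform_point_itv t0 N0 (ltnW (ltn_ord k)).
Unshelve. all: by end_near. Qed.

End doss_sussmann.

(** * Norms, and Hausdorff measure under Lipschitz maps *)

Section norms.
Context {R : realType} {n : nat}.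
Implicit Types v : 'rV[R]_n.

Lemma coord_le_norm v i : `|v 0 i| <= `|v|.
Proof. by rewrite [leRHS]/Num.norm /= mx_normrE; exact: (le_bigmax _ _ (0, i)). Qed.

Lemma norm_rV_le v (c : R) : 0 <= c -> (forall i, `|v 0 i| <= c) -> `|v| <= c.
Proof.
move=> c0 vc; rewrite [leLHS]/Num.norm /= mx_normrE; apply/bigmax_leP; split => //.
by case=> i j _ /=; rewrite (ord1 i).
Qed.

Lemma norm_le_sum_coord v : `|v| <= \sum_i `|v 0 i|.
Proof.
apply: norm_rV_le => [|i]; first exact: sumr_ge0.
by rewrite (bigD1 i)//= lerDl; exact: sumr_ge0.
Qed.

Lemma enorm2_ge0 v : 0 <= enorm2 v.
Proof. exact: sqrtr_ge0. Qed.

Lemma norm_le_enorm2 v : `|v| <= enorm2 v.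
Proof.
apply: norm_rV_le => [|i]; first exact: enorm2_ge0.
rewrite -sqrtr_sqr ler_wsqrtr// (bigD1 i)//= lerDl.
by apply: sumr_ge0 => j _; exact: sqr_ge0.
Qed.

Lemma enorm2_le_norm v : enorm2 v <= Num.sqrt n%:R * `|v|.
Proof.
rewrite -[`|v|]normr_id -sqrtr_sqr -sqrtrM// ler_wsqrtr//.
apply: (@le_trans _ _ (\sum_(i < n) `|v| ^+ 2)).
  apply: ler_sum => i _; rewrite -real_normK ?num_real//.
  by rewrite lerXn2r ?nnegrE// coord_le_norm.
by rewrite sumr_const card_ord mulr_natl.
Qed.

End norms.

Section hausdorff_ge0.
Context {R : realType} {n : nat}.
Local Open Scope ereal_scope.
Implicit Types A : set 'rV[R]_n.

Lemma ediam_ge0 A : A !=set0 -> 0 <= ediam A.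
Proof.
move=> [a Aa]; apply: (@le_trans _ _ (enorm2 (a - a))%:E).
  by rewrite lee_fin; exact: enorm2_ge0.
by apply: ereal_sup_ubound; exists a => //; exists a.
Qed.

Lemma hausdorff_gauge_ge0 m A : 0 <= hausdorff_gauge m A.
Proof.
rewrite /hausdorff_gauge; case: ifPn => // /set0P A0.
by apply: expe_ge0; exact: ediam_ge0.
Qed.

Lemma hausdorff_measure_ge0 m A : 0 <= hausdorff_measure m A.
Proof.
apply: (@le_trans _ _ (hausdorff_pre m 1 A)); last first.
  by apply: ereal_sup_ubound; exists 1%R => //=; exact: ltr01.
apply: le_ereal_inf_tmp => _ [F _ <-].
by apply: nneseries_ge0 => k _ _; exact: hausdorff_gauge_ge0.
Qed.

End hausdorff_ge0.

Section hausdorff_lipschitz.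
Context {R : realType} {n n' : nat}.
Local Open Scope ereal_scope.
Implicit Types A : set 'rV[R]_n.
Variables (F : 'rV[R]_n -> 'rV[R]_n') (K : R).
Hypotheses (K0 : (0 < K)%R)
  (lipF : forall x y, (enorm2 (F x - F y) <= K * enorm2 (x - y))%R).

Lemma ediam_lipschitz A : ediam (F @` A) <= K%:E * ediam A.
Proof.
apply: ge_ereal_sup => _ [_ [x Ax <-] [_ [y Ay <-] <-]].
apply: (@le_trans _ _ (K * enorm2 (x - y))%:E); first by rewrite lee_fin lipF.
rewrite EFinM lee_pmul2l//; apply: ereal_sup_ubound.
by exists x => //; exists y.
Qed.

Lemma hausdorff_gauge_lipschitz m A :
  hausdorff_gauge m (F @` A) <= (K ^+ m)%:E * hausdorff_gauge m A.
Proof.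
rewrite /hausdorff_gauge; have [->|A0] := eqVneq A set0.
  by rewrite image_set0 eqxx mule0.
move/set0P : A0 => A0.
have FA0 : F @` A !=set0 by case: A0 => a Aa; exists (F a); exists a.
rewrite ifF; last by apply/negbTE/set0P.
elim: m => [|m IH]; first by rewrite !expe0 mul1e.
rewrite !expeS exprS EFinM muleACA; apply: lee_pmul => //.
- exact: ediam_ge0.
- by apply: expe_ge0; exact: ediam_ge0.
- exact: ediam_lipschitz.
Qed.

Lemma hausdorff_measure_lipschitz m A :
  hausdorff_measure m (F @` A) <= (K ^+ m)%:E * hausdorff_measure m A.
Proof.
have Km0 : (0 < K ^+ m)%R by rewrite exprn_gt0.
apply: ge_ereal_sup => _ [delta /= delta0 <-].
apply: (@le_trans _ _ ((K ^+ m)%:E * hausdorff_pre m (delta / K) A)); last first.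
  rewrite lee_pmul2l//; apply: ereal_sup_ubound; exists (delta / K)%R => //=.
  by rewrite divr_gt0.
rewrite -lee_pdivrMl//; apply: le_ereal_inf_tmp => _ [S [AS diamS] <-].
rewrite lee_pdivrMl// -nneseriesZl; last by move=> k _; exact: hausdorff_gauge_ge0.
apply: (@le_trans _ _ (\sum_(0 <= k <oo) hausdorff_gauge m (F @` S k))).
  apply: ereal_inf_lbound; exists (fun k => F @` S k) => //; split.
    move=> _ [x /AS [k _ Skx] <-]; exists k => //; by exists x.
  move=> k; apply: le_trans (ediam_lipschitz _) _.
  by rewrite muleC -lee_pdivlMr// -EFinM; exact: diamS.
apply: lee_nneseries => k _; first by move=> _; exact: hausdorff_gauge_ge0.
exact: hausdorff_gauge_lipschitz.
Qed.

End hausdorff_lipschitz.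

(** * Hoelder paths *)

Section holder.
Context {R : realType}.

Lemma holder_norm_ge (V : zmodType) (N : V -> R) (lam T : R) (f : R -> V) c d :
  0 <= c -> c < d -> d <= T ->
  ((N (f d - f c) / `|d - c| `^ lam)%:E <= holder_norm N lam T f)%E.
Proof. by move=> c0 cd dT; apply: ereal_sup_ubound; exists c, d. Qed.

Lemma holder_norm_fin_bound (V : zmodType) (N : V -> R) (lam T : R) (f : R -> V) :
  (holder_norm N lam T f < +oo)%E ->
  exists2 K, 0 <= K & forall c d, 0 <= c -> c < d -> d <= T ->
    N (f d - f c) <= K * `|d - c| `^ lam.
Proof.
move=> fin; exists (Num.max 0 (fine (holder_norm N lam T f))).
  by rewrite le_max lexx.
move=> c d c0 cd dT; have := holder_norm_ge N lam f c0 cd dT.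
have p0 : 0 < `|d - c| `^ lam by rewrite powR_gt0// normr_gt0 subr_eq0 gt_eqF.
move: fin; case: (holder_norm N lam T f) => [r| |] //= _; rewrite lee_fin => h.
by rewrite -ler_pdivrMr// le_max h orbT.
Qed.

Lemma holder_modulus {V : normedModType R} (lam K a b : R) (f : R -> V) :
  (forall c d, a <= c -> c < d -> d <= b -> `|f d - f c| <= K * `|d - c| `^ lam) ->
  0 <= K -> forall c d, a <= c <= b -> a <= d <= b ->
    `|f d - f c| <= K * `|d - c| `^ lam.
Proof.
move=> fK K0 c d /andP[ac cb] /andP[ad db]; have [cd|dc|->] := ltgtP c d.
- exact: fK.
- by rewrite distrC (distrC d); exact: fK.
- by rewrite !subrr normr0 mulr_ge0// powR_ge0.
Qed.

Lemma exists_powR_le (p e : R) : 0 < p -> 0 < e ->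
  exists2 d, 0 < d & forall h, 0 <= h <= d -> h `^ p <= e.
Proof.
move=> p0 e0; exists (e `^ p^-1); first exact: powR_gt0.
move=> h /andP[h0 hd].
have -> : e = (e `^ p^-1) `^ p by rewrite -powRrM mulVf ?gt_eqF// powRr1// ltW.
by apply: ge0_ler_powR; rewrite ?nnegrE ?powR_ge0// ltW.
Qed.

Lemma holder_continuous {V : normedModType R} (lam K a b : R) (f : R -> V) t :
  0 < lam -> 0 <= K ->
  (forall c d, a <= c <= b -> a <= d <= b -> `|f d - f c| <= K * `|d - c| `^ lam) ->
  a < t < b -> {for t, continuous f}.
Proof.
move=> lam0 K0 fK tab; apply/cvgrPdist_le => e e0.
have K1 : 0 < K + 1 by rewrite ltr_wpDl.
have eK : 0 < e / (K + 1) by exact: divr_gt0.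
have [d d0 small] := exists_powR_le lam0 eK.
have tab' : a <= t <= b by case/andP: tab => /ltW -> /ltW ->.
near=> s.
have sab : a <= s <= b.
  have : s \in `]a, b[ by near: s; exact: near_in_itvoo.
  by rewrite in_itv /= => /andP[/ltW -> /ltW ->].
have ts : `|t - s| <= d by near: s; apply: cvgr_dist_le => //; exact: cvg_id.
apply: le_trans (fK _ _ sab tab') _.
apply: (@le_trans _ _ ((K + 1) * `|t - s| `^ lam)).
  by rewrite ler_wpM2r ?powR_ge0// lerDl.
by rewrite mulrC -ler_pdivlMr//; apply: small; rewrite normr_ge0.
Unshelve. all: by end_near. Qed.

(** With mesh [h], the sum is at most [K ^ 2 (b - a) h ^ (2 lam - 1)]. *)
Lemma holder_sum_squares {V : normedModType R} (lam K a b eps : R) (f : R -> V) :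
  2^-1 < lam -> 0 <= K -> a < b ->
  (forall c d, a <= c <= b -> a <= d <= b -> `|f d - f c| <= K * `|d - c| `^ lam) ->
  0 < eps -> \forall N \near \oo,
    \sum_(k < N) `|f (uniform_point a b N k.+1) - f (uniform_point a b N k)| ^+ 2
      <= eps.
Proof.
move=> lam2 K0 ab fK eps0.
pose C := K ^+ 2 * (b - a) + 1.
have ba0 : 0 <= b - a by rewrite subr_ge0 ltW.
have C0 : 0 < C by rewrite ltr_wpDl// mulr_ge0// exprn_ge0.
have p0 : 0 < lam * 2 - 1 by rewrite subr_gt0 -ltr_pdivrMr// mul1r.
have [d d0 small] := exists_powR_le p0 (divr_gt0 eps0 C0).
near=> N.
have N0 : (0 < N)%N by near: N; exact: nbhs_infty_gt.
have NR : 0 < N%:R :> R by rewrite ltr0n.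
set h := (b - a) / N%:R.
have h0 : 0 < h by rewrite divr_gt0 ?subr_gt0.
have hd : h <= d.
  rewrite ler_pdivrMr// mulrC -ler_pdivrMr// ltW//.
  by near: N; exact: nbhs_infty_gtr.
apply: (@le_trans _ _ (\sum_(k < N) K ^+ 2 * (h * h `^ (lam * 2 - 1)))).
  apply: ler_sum => k _.
  have -> : h * h `^ (lam * 2 - 1) = (h `^ lam) ^+ 2.
    rewrite -powR_mulrn ?powR_ge0// -powRrM -{1}[h]powRr1 ?(ltW h0)//.
    rewrite -powRD ?(gt_eqF h0) ?implybT//; congr (_ `^ _); ring.
  rewrite -exprMn lerXn2r ?nnegrE ?mulr_ge0 ?powR_ge0//.
  apply: le_trans (fK _ _ _ _) _; rewrite ?uniform_point_itv//; first exact: ltnW.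
  by rewrite uniform_pointS ger0_norm ?(ltW h0).
rewrite sumr_const card_ord -[leLHS]mulr_natr.
have -> : K ^+ 2 * (h * h `^ (lam * 2 - 1)) * N%:R =
    K ^+ 2 * (b - a) * h `^ (lam * 2 - 1).
  rewrite -[X in _ = _ * X * _](divfK (lt0r_neq0 NR)) -/h; ring.
apply: (@le_trans _ _ (C * h `^ (lam * 2 - 1))).
  by rewrite ler_wpM2r ?powR_ge0// lerDl.
by rewrite mulrC -ler_pdivlMr//; apply: small; rewrite hd ltW.
Unshelve. all: by end_near. Qed.

End holder.

(** * The flow of the driven equation *)

Lemma near_sum_RS_remainder {R : realType} (f g J : R -> R) (a b eps : R) :
  (forall t, 0 <= t -> is_RS_integral f g 0 t (J t)) ->
  0 <= a -> a < b -> 0 < eps -> \forall N \near \oo,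
  \sum_(k < N) `|RS_remainder f g J (uniform_point a b N k) (uniform_point a b N k.+1)|
    <= eps.
Proof.
move=> fgJ a0 ab eps0.
have [d d0 small] := sum_RS_remainder_le fgJ a0 (ltW ab) eps0.
near=> N.
have N0 : (0 < N)%N by near: N; exact: nbhs_infty_gt.
apply: small.
- exact: uniform_point0.
- exact: uniform_point_last.
- by move=> k; exact: uniform_point_lt.
- move=> k; rewrite uniform_pointS ltr_pdivrMr ?ltr0n// mulrC -ltr_pdivrMr//.
  by near: N; exact: nbhs_infty_gtr.
Unshelve. all: by end_near. Qed.

(* Completeness and the norm of row vectors, joined so that [euler_flow] applies to
them. *)
HB.instance Definition _ (R : realType) (m n : nat) := Complete.on 'M[R]_(m, n).

Section rough_flow.
Context {R : realType} {n : nat}.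
Variables (U : 'rV[R]_n -> 'rV[R]_n) (M_U M_U1 : R).
Hypotheses (U_bounded : forall x (i : 'I_n), `|U x 0 i| <= M_U)
  (U_lipschitz : forall x y (i : 'I_n),
     `|U x 0 i - U y 0 i| <= M_U1 * enorm2 (x - y)).
Variables (lam : R) (g : R -> R) (Phi : R -> 'rV[R]_n -> 'rV[R]_n).
Hypotheses (lam_gt : 2^-1 < lam) (cg : {within `[0, +oo[, continuous g})
  (flowPhi : is_flow lam U g Phi).

Let L := `|M_U1| * Num.sqrt n%:R.

Let L0 : 0 <= L. Proof. by rewrite mulr_ge0// sqrtr_ge0. Qed.

Let boundU x : `|U x| <= `|M_U|.
Proof. by apply: norm_rV_le => // i; apply: le_trans (U_bounded x i) (ler_norm _). Qed.

Let lipU x y : `|U x - U y| <= L * `|x - y|.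
Proof.
apply: norm_rV_le => [|i]; first by rewrite mulr_ge0.
rewrite !mxE; apply: le_trans (U_lipschitz x y i) _.
apply: (@le_trans _ _ (`|M_U1| * enorm2 (x - y))).
  by rewrite ler_wpM2r ?ler_norm//; exact: enorm2_ge0.
by rewrite -mulrA ler_wpM2l//; exact: enorm2_le_norm.
Qed.

Lemma flow_start x : Phi 0 x = x.
Proof.
have [_ eqPhi] := flowPhi x; apply/rowP => i; apply/eqP.
rewrite -subr_eq0 -normr_le0; apply/ler_addgt0Pr => e e0; rewrite add0r.
have [d d0 /(_ [::] (fun=> 0))] := eqPhi 0 (lexx _) i e e0.
by rewrite /= big_ord0 sub0r normrN => h; apply/ltW/h => //; split.
Qed.

(** Composing paths with [pos] extends them by their initial values, which removes
the boundary at time 0 from all continuity statements. *)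
Let pos (t : R) : R := Num.max t 0.

Let pos_ge0 t : 0 <= pos t. Proof. by rewrite /pos le_max lexx orbT. Qed.

Let posE t : 0 <= t -> pos t = t. Proof. by move=> t0; rewrite /pos max_l. Qed.

Let dist_pos s t : `|pos s - pos t| <= `|s - t|.
Proof.
rewrite /pos; case: (leP s 0) => s0; case: (leP t 0) => t0.
- by rewrite subrr normr0.
- rewrite sub0r normrN distrC !ger0_norm ?subr_ge0 ?(ltW t0)//; first lra.
  exact: le_trans s0 (ltW t0).
- rewrite subr0 !ger0_norm ?subr_ge0 ?(ltW s0)//; first lra.
  exact: le_trans t0 (ltW s0).
- by [].
Qed.

Let continuous_pos : continuous pos.
Proof.
move=> t; apply/cvgrPdist_le => e e0; near=> s.
apply: le_trans (dist_pos _ _) _.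
by near: s; apply: cvgr_dist_le => //; exact: cvg_id.
Unshelve. all: by end_near. Qed.

Let continuous_gpos : continuous (g \o pos).
Proof.
move=> t; have /subspace_continuousP cgt := cg.
have pt : `[0, +oo[%classic (pos t) by rewrite /= in_itv /= pos_ge0.
apply: cvg_comp (cgt _ pt).
move=> A /= wA; near=> s.
have : `[0, +oo[%classic (pos s) by rewrite /= in_itv /= pos_ge0.
by near: s; apply: (continuous_pos wA).
Unshelve. all: by end_near. Qed.

Let holder_pos x T : 0 < T -> exists2 K, 0 <= K &
  forall c d, - T <= c <= T -> - T <= d <= T ->
    `|Phi (pos d) x - Phi (pos c) x| <= K * `|d - c| `^ lam.
Proof.
move=> T0; have [/(_ _ T0)/holder_norm_fin_bound [K K0 bd] _] := flowPhi x.
exists K => // c d cT dT.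
have bd' c' d' : 0 <= c' -> c' < d' -> d' <= T -> 
    `|(Phi^~ x) d' - (Phi^~ x) c'| <= K * `|d' - c'| `^ lam.
  by move=> c0 cd dT'; apply: le_trans (norm_le_enorm2 _) _; exact: bd.
have posT t : - T <= t <= T -> 0 <= pos t <= T.
  by case/andP=> _ tT; rewrite pos_ge0 /pos ge_max tT ltW.
have lam0 : 0 <= lam by apply: le_trans (ltW lam_gt).
apply: le_trans (holder_modulus bd' K0 (posT _ cT) (posT _ dT)) _.
by rewrite ler_wpM2l// ge0_ler_powR ?nnegrE.
Qed.

Let continuous_Phi_pos x : continuous (fun t => Phi (pos t) x).
Proof.
move=> t; have T0 : 0 < `|t| + 1 by rewrite ltr_wpDl.
have [K K0 bd] := holder_pos x T0.
have lam0 : 0 < lam by apply: le_lt_trans lam_gt.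
apply: (holder_continuous lam0 K0 bd).
by rewrite -ltr_norml ltrDl.
Qed.

(** The integral equation holds coordinate by coordinate, and the norm of a vector
remainder is at most the sum of the remainders of its coordinates. *)
Lemma flow_eq_euler_flow t x : 0 <= t -> Phi t x = euler_flow U (g t - g 0) x.
Proof.
move=> t0.
have := solution_is_flow L0 boundU lipU continuous_gpos (@continuous_Phi_pos x) _ _ t0.
rewrite /= !posE// flow_start; apply => {t t0} a b eps a0 ab eps0.
- have [_ eqPhi] := flowPhi x.
  have small (i : 'I_n) : \forall N \near \oo, \sum_(k < N)
      `|RS_remainder (fun s => U (Phi s x) 0 i) g (fun t => Phi t x 0 i - x 0 i)
          (uniform_point a b N k) (uniform_point a b N k.+1)| <= eps / n.+1%:R.
    apply: near_sum_RS_remainder => //; last exact: divr_gt0.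
    by move=> t t0; exact: eqPhi.
  near=> N.
  have N0 : (0 < N)%N by near: N; exact: nbhs_infty_gt.
  have smallN : forall i : 'I_n, \sum_(k < N)
      `|RS_remainder (fun s => U (Phi s x) 0 i) g (fun t => Phi t x 0 i - x 0 i)
          (uniform_point a b N k) (uniform_point a b N k.+1)| <= eps / n.+1%:R.
    by near: N; exact: filter_forall.
  apply: (@le_trans _ _ (\sum_(k < N) \sum_i
      `|RS_remainder (fun s => U (Phi s x) 0 i) g (fun t => Phi t x 0 i - x 0 i)
          (uniform_point a b N k) (uniform_point a b N k.+1)|)).
    apply: ler_sum => k _; apply: le_trans (norm_le_sum_coord _) _.
    apply: ler_sum => i _; rewrite !mxE /RS_remainder /=.
    have /andP[k0 _] := uniform_point_itv ab N0 (ltnW (ltn_ord k)).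
    have /andP[k1 _] := uniform_point_itv ab N0 (ltn_ord k).
    rewrite !posE ?(le_trans a0)//.
    by rewrite le_eqVlt; apply/orP; left; apply/eqP; congr (`|_|); ring.
  rewrite exchange_big /=; apply: (@le_trans _ _ (\sum_(i < n) eps / n.+1%:R)).
    by apply: ler_sum => i _; apply: smallN.
  rewrite sumr_const card_ord -[leLHS]mulr_natr -mulrA ler_piMr ?(ltW eps0)//.
  by rewrite mulrC ler_pdivrMr// mul1r ler_nat.
- have b0 : 0 < b by exact: le_lt_trans ab.
  have [K K0 bd] := holder_pos x b0.
  apply: (holder_sum_squares (f := fun t => Phi (pos t) x) lam_gt K0 ab) => //.
  have ba : - b <= a by apply: le_trans a0; rewrite oppr_le0 ltW.
  by move=> c d /andP[ac cb] /andP[ad db]; apply: bd; rewrite ?cb ?db (le_trans ba).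
Unshelve. all: by end_near. Qed.

(** The factor [sqrt n] compares the Euclidean norm with the supremum norm, for
which the flow was built. *)
Lemma flow_lipschitz t x y : 0 <= t ->
  enorm2 (Phi t x - Phi t y) <=
    Num.sqrt n%:R * expR (L * `|g t - g 0|) * enorm2 (x - y).
Proof.
move=> t0; rewrite !flow_eq_euler_flow//.
apply: le_trans (enorm2_le_norm _) _; rewrite -mulrA ler_wpM2l ?sqrtr_ge0//.
apply: le_trans (euler_flow_lipschitz L0 boundU lipU _ _ _) _.
by rewrite ler_wpM2l ?expR_ge0//; exact: norm_le_enorm2.
Qed.

End rough_flow.

(** * Growth of the Hausdorff measure *)

(** For [beta <= 1] one has [y <= 1 + y ^ (1 / beta)].  The exponent uses [a + 1]
rather than [a] so that its coefficient is positive even when [a = 0]. *)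
Lemma expR_le_pow2 {R : realType} (a y beta : R) : 0 <= a -> 0 <= y ->
  0 < beta -> beta <= 1 ->
  expR (a * y) <= expR a * 2 `^ ((a + 1) / ln 2 * y `^ beta^-1).
Proof.
move=> a0 y0 beta0 beta1.
have ln2 : 0 < ln 2 :> R by rewrite ln_gt0// ltr1n.
have pow2E (x : R) : 2 `^ x = expR (x * ln 2) by rewrite /powR gt_eqF.
rewrite pow2E; set z := y `^ _; have z0 : 0 <= z by exact: powR_ge0.
rewrite [_ * ln 2]mulrAC divfK ?gt_eqF// -expRD ler_expR.
have yz : y <= 1 + z.
  have [y1|/ltW y1] := leP y 1; first by rewrite (le_trans y1)// lerDl.
  apply: (@le_trans _ _ z); last by rewrite lerDr.
  rewrite -[leLHS]powRr1// /z; apply: ler_powR => //.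
  by rewrite invf_ge1.
apply: (@le_trans _ _ (a * (1 + z))); first by rewrite ler_wpM2l.
by rewrite mulrDr mulr1 lerD2l mulrDl lerDl mul1r.
Qed.

Theorem theorem1p1 (R : realType) (d : measure_display)
  (Omega : measurableType d) (P : probability Omega R)
  (H : R) (H_gt : 2^-1 < H) (H_lt : H < 1)
  (B : R -> {RV P >-> R}) (fbmB : fractional_brownian_motion H B)
  (m n : nat) (mn : (m < n)%N)
  (U : 'rV[R]_n -> 'rV[R]_n) (M_U M_U1 M_U2 : R)
  (U_derivable : forall (x : 'rV[R]_n) (i j : 'I_n),
     derivable (fun y : 'rV[R]_n => U y 0 i) x (delta_mx 0 j))
  (U_bounded : forall x (i : 'I_n), `|U x 0 i| <= M_U)
  (U_lipschitz : forall x y (i : 'I_n),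
     `|U x 0 i - U y 0 i| <= M_U1 * enorm2 (x - y))
  (W_lipschitz : forall x y (i j : 'I_n),
     `|partial j (fun z => U z 0 i) x - partial j (fun z => U z 0 i) y|
     <= M_U2 * enorm2 (x - y))
  (alpha : R) (alpha_gt : 1 - H < alpha) (alpha_lt : alpha < 2^-1)
  (Phi : Omega -> R -> 'rV[R]_n -> 'rV[R]_n)
  (flowPhi : {ae P, forall w, is_flow (1 - alpha) U (fun t => B t w) (Phi w)})
  (M : set 'rV[R]_n) (manifM : embedded_submanifold 2 m M) :
  forall beta : R, 0 < beta -> beta < H ->
  exists c1 C1 : R, forall T : R, 0 < T ->
  {ae P, forall w,
    (ereal_sup [set hausdorff_measure m (Phi w t @` M) | t in `[0%R, T]%classic]
     <= c1%:E * hausdorff_measure m M *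
        pow2e (C1%:E * T%:E *
               holder_norm Num.norm beta T (fun t => B t w) `^ beta^-1))%E}.
Proof.
move=> beta beta0 betaH.
pose L := `|M_U1| * Num.sqrt n%:R.
pose a := m%:R * L.
have L0 : 0 <= L by rewrite mulr_ge0// sqrtr_ge0.
have a0 : 0 <= a by rewrite mulr_ge0.
have n0 : 0 < Num.sqrt n%:R :> R by rewrite sqrtr_gt0 ltr0n (leq_trans _ mn).
have ln2 : 0 < ln 2 :> R by rewrite ln_gt0// ltr1n.
have beta1 : beta <= 1 by apply: ltW; exact: lt_trans H_lt.
pose c1 := Num.sqrt n%:R ^+ m * expR a; pose C1 := (a + 1) / ln 2.
have c10 : 0 < c1 by rewrite mulr_gt0 ?exprn_gt0 ?expR_gt0.
have C10 : 0 < C1 by rewrite divr_gt0// ltr_wpDl.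
exists c1, C1 => T T0; apply: filterS flowPhi => w flow_w.
set g := fun t => B t w.
have cg : {within `[0, +oo[, continuous g} by case: fbmB => _ _ _; apply.
have lam_gt : 2^-1 < 1 - alpha by move: alpha_lt; lra.
have HM := hausdorff_measure_ge0 m M.
apply: ge_ereal_sup => _ [t /= + <-]; rewrite in_itv /= => /andP[t0 tT].
pose K := Num.sqrt n%:R * expR (L * `|g t - g 0|).
have K0 : 0 < K by rewrite mulr_gt0 ?expR_gt0.
have lipK x y : enorm2 (Phi w t x - Phi w t y) <= K * enorm2 (x - y).
  exact: (flow_lipschitz U_bounded U_lipschitz lam_gt cg flow_w).
apply: le_trans (hausdorff_measure_lipschitz K0 lipK m M) _.
have : (0 <= holder_norm Num.norm beta T g)%E.
  apply: le_trans (holder_norm_ge Num.norm beta g (lexx 0) T0 (lexx T)).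
  by rewrite lee_fin divr_ge0// powR_ge0.
have bound_t : 0 < t ->
    ((`|g t - g 0| / t `^ beta)%:E <= holder_norm Num.norm beta T g)%E.
  move=> tpos; have := holder_norm_ge Num.norm beta g (lexx 0) tpos tT.
  by rewrite subr0 (gtr0_norm tpos).
case: (holder_norm _ _ _ _) bound_t => [r bound_t r0|bound_t _|_ //=]; last first.
  (* If the Hoelder norm is infinite, so is the right-hand side, unless [M] is a
     null set; then [0 * +oo = 0] and the left-hand side vanishes as well. *)
  have [->|HM0] := eqVneq (hausdorff_measure m M) 0%E; first by rewrite !mule0 mul0e.
  have HM1 : (0 < hausdorff_measure m M)%E by rewrite lt0e HM0.
  rewrite poweRyr ?invr_eq0 ?gt_eqF// -EFinM gt0_muley ?lte_fin ?(mulr_gt0 C10 T0)//=.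
  by rewrite gt0_muley ?leey// mule_gt0.
rewrite lee_fin in r0.
rewrite poweR_EFin -!EFinM /= muleAC -EFinM.
apply: lee_wpmul2r => //; rewrite lee_fin.
pose y := r * T `^ beta.
have y0 : 0 <= y by rewrite mulr_ge0// powR_ge0.
have gy : `|g t - g 0| <= y.
  have [tpos|] := ltP 0 t; last first.
    move=> t0'; have -> : t = 0 by apply/le_anti; rewrite t0'.
    by rewrite subrr normr0.
  apply: (@le_trans _ _ (r * t `^ beta)).
    by rewrite -ler_pdivrMr ?powR_gt0//; have := bound_t tpos; rewrite lee_fin.
  by rewrite ler_wpM2l// ge0_ler_powR ?nnegrE ?(ltW beta0) ?(ltW T0).
have -> : C1 * T * r `^ beta^-1 = C1 * y `^ beta^-1.
  rewrite /y powRM ?powR_ge0// -powRrM mulfV ?gt_eqF// powRr1 ?(ltW T0)//; ring.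
rewrite /K /c1 exprMn -[leRHS]mulrA ler_wpM2l ?exprn_ge0 ?(ltW n0)//.
apply: le_trans (expR_le_pow2 a0 y0 beta0 beta1).
rewrite -expRM_natl ler_expR. by rewrite mulrA ler_wpM2l.
Qed.
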